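(* Let $\lambda^{*}=(\sqrt{2}+1)e^{\sqrt{2}}$, $1<\lambda<\lambda^{*}$ and $\zeta_\lambda(z)=\lambda\frac{z}{z+1}e^{-z}$. Let $a_\lambda$ be the unique nonzero real fixed point of $\zeta_\lambda$ (it lies in $(0,\sqrt2)$ and is attracting), and let $A(a_\lambda)=\{z\in\mathbb{C}:\zeta_\lambda^{n}(z)\to a_\lambda \text{ as } n\to\infty\}$ be its basin of attraction. Then $J(\zeta_\lambda)=\hat{\mathbb{C}}\setminus A(a_\lambda)$.
   Context: $\hat{\mathbb{C}}$ is the extended complex plane. For the transcendental meromorphic function $\zeta_\lambda$, the Fatou set is the set of points of $\hat{\mathbb{C}}$ having a neighbourhood on which all iterates $\zeta_\lambda^{n}$ are defined and form a normal family; the Julia set $J(\zeta_\lambda)$ is its complement. *)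

(* Defs.v *)
From Stdlib Require Import Reals.
From Coquelicot Require Import Coquelicot.
Open Scope R_scope.

Definition Cexp (z : C) : C :=
  (exp (fst z) * cos (snd z), exp (fst z) * sin (snd z)).

(* The extended complex plane: [Some z] is the finite point z, [None] is oo. *)
Definition Chat := option C.

(* zeta_lambda(z) = lambda * z/(z+1) * e^(-z) on C (meaningful for z <> -1). *)
Definition zeta (lam : R) (z : C) : C :=
  Cmult (Cmult (RtoC lam) (Cdiv z (Cplus z (RtoC 1)))) (Cexp (Copp z)).

(* zeta_lambda as a (partial) map on the extended plane: the pole -1 goes to oo.
   zeta_lambda is NOT defined at oo (essential singularity); the value [None]
   there is a junk value, and definedness of iterates is tracked by
   [iter_defined] below. *)
Definition zetah (lam : R) (w : Chat) : Chat :=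
  match w with
  | None => None
  | Some z =>
      match Req_EM_T (fst z) (-1), Req_EM_T (snd z) 0 with
      | left _, left _ => None
      | _, _ => Some (zeta lam z)
      end
  end.

Definition iterh (lam : R) (n : nat) (w : Chat) : Chat := Nat.iter n (zetah lam) w.

(* zeta^n is defined at w: the points w, zeta w, ..., zeta^(n-1) w are all finite
   (zeta^n w itself may be oo, as for a meromorphic function). *)
Definition iter_defined (lam : R) (n : nat) (w : Chat) : Prop :=
  forall k, (k < n)%nat -> iterh lam k w <> None.

Definition sigma (w v : Chat) : R :=
  match w, v with
  | Some z, Some u =>
      2 * Cmod (Cminus z u) / sqrt ((1 + Cmod z ^ 2) * (1 + Cmod u ^ 2))
  | Some z, None => 2 / sqrt (1 + Cmod z ^ 2)
  | None, Some u => 2 / sqrt (1 + Cmod u ^ 2)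
  | None, None => 0
  end.

Definition chat_open (U : Chat -> Prop) : Prop :=
  forall w, U w -> exists r, 0 < r /\ forall v, sigma w v < r -> U v.

Definition loc_unif_cvg (U : Chat -> Prop) (f : nat -> Chat -> Chat)
    (g : Chat -> Chat) : Prop :=
  forall w, U w -> exists r, 0 < r /\ (forall v, sigma w v < r -> U v) /\
    forall eps, 0 < eps -> exists N, forall k, (N <= k)%nat ->
      forall v, sigma w v < r -> sigma (f k v) (g v) < eps.

Definition normal_iterates_on (lam : R) (U : Chat -> Prop) : Prop :=
  forall m : nat -> nat, exists phi : nat -> nat,
    (forall k, (phi k < phi (S k))%nat) /\
    exists g : Chat -> Chat, loc_unif_cvg U (fun k => iterh lam (m (phi k))) g.

Definition fatou (lam : R) (w : Chat) : Prop :=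
  exists U : Chat -> Prop, chat_open U /\ U w /\
    (forall n v, U v -> iter_defined lam n v) /\ normal_iterates_on lam U.

Definition julia (lam : R) (w : Chat) : Prop := ~ fatou lam w.

Definition basin (lam : R) (a : C) (w : Chat) : Prop :=
  (exists z, w = Some z) /\
  (forall n, iterh lam n w <> None) /\
  forall eps, 0 < eps -> exists N, forall n, (N <= n)%nat ->
    exists zn, iterh lam n w = Some zn /\ Cmod (Cminus zn a) < eps.

(* Main.v *)
From Stdlib Require Import Reals Lra Lia Psatz Classical ClassicalEpsilon.
From Coquelicot Require Import Coquelicot.
Require Import Defs.
Open Scope R_scope.

(** All singular values of [zeta] lie in [[0, oo]], and [(0, oo)] is attracted to [a], so on the
    slit plane [Omega = C \ [0, oo)] the map expands the hyperbolic metric, whose density is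
    [1 / sqrt (2 |z| (|z| - Re z))] because [sqrt (- z)] maps [Omega] to the right half-plane.
    The expansion is the explicit inequality [expansion], uniform away from [0] and from the
    positive axis. If a disc misses the basin then all its iterates stay in [Omega], and the
    Schwarz lemma bounds the hyperbolic derivatives of the iterates at its centre; hence the
    centre's orbit eventually stays near [0] or near the positive axis. Near a compact part of
    the axis it would be attracted, near [+ oo] it is sent close to [0], and [0] repels it: a
    contradiction. So the basin is dense, and a point where the iterates are equicontinuous and
    which is a limit of basin points belongs to the basin. *)

(** * Expansion of the hyperbolic metric of the slit plane *)

(** In [expansion] the parameter [lam] cancels: the ratio of the densities at [z] and at its image
    depends on [z] alone. So [lam] enters only through the dynamics on the positive axis and the
    multiplier [lam > 1] at 0. The explicit inequality stands in for the fact that [zeta] is a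
    covering over the slit plane. No uniform factor above 1 can exist. Near 0 the map is close to
    [z -> lam z], an isometry of the slit plane, and near a noncritical point of the positive axis a
    conformal map preserving the axis is almost isometric. Hence the expansion can only push an
    orbit towards these two places, and separate estimates have to finish. The multiplier at [a] is
    [(1 - a - a^2) / (1 + a)], which reaches -1 exactly at [a = sqrt 2]; [lam_star] is the parameter
    whose fixed point is [sqrt 2]. Below it local attraction is immediate, but attraction of the
    whole axis requires excluding 2-cycles, which is the purpose of [ldiff]. *)

Lemma one_minus_cos_le (t : R) : 1 - cos t <= t ^ 2 / 2.
Proof.
  assert (H : forall u, 0 <= u -> sin u <= u).
  { intros u [Hu | <-]; [now left; apply sin_lt_x | rewrite sin_0; lra]. }
  (* With [H] this gives [sin u ^ 2 <= u ^ 2] by factoring the difference of squares. *)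
  assert (H2 : forall u, 0 <= u -> 0 <= u + sin u).
  { intros u Hu. destruct (Rle_lt_dec u 1) as [H1 | H1].
    - enough (0 <= sin u) by lra. apply sin_ge_0; [easy|]. generalize PI2_1; lra.
    - generalize (SIN_bound u); lra. }
  replace t with (2 * (t / 2)) at 1 by field. rewrite cos_2a_sin.
  enough (sin (t / 2) * sin (t / 2) <= t / 2 * (t / 2)) by nra.
  destruct (Rle_dec 0 (t / 2)) as [Ht | Ht].
  - specialize (H _ Ht); specialize (H2 _ Ht); nra.
  - assert (Ht' : 0 <= - (t / 2)) by lra.
    specialize (H _ Ht'); specialize (H2 _ Ht'). rewrite sin_neg in H, H2; nra.
Qed.

Lemma sin_sub_bound (psi y : R) : 0 <= y -> sin psi - y <= sin (psi - y).
Proof.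
  intros [Hy | <-]; [|now replace (psi - 0) with psi by ring; lra].
  destruct (MVT_cor2 sin cos (psi - y) psi) as (c & Hc & _); [lra | intros; apply derivable_pt_lim_sin |].
  generalize (COS_bound c); nra.
Qed.

Lemma cos_sub_taylor (psi y : R) : 0 <= y ->
  cos psi + y * sin psi - y ^ 2 / 2 <= cos (psi - y).
Proof.
  intros [Hy | <-]; [|now replace (psi - 0) with psi by ring; lra].
  destruct (MVT_cor2 (fun t => cos (psi - t) - t * sin psi + t ^ 2 / 2)
     (fun t => sin (psi - t) - sin psi + t) 0 y Hy) as (c & Hc & H).
  - intros t _. apply is_derive_Reals. auto_derive; [easy | unfold Rminus; field].
  - rewrite Rminus_0_r in Hc. generalize (sin_sub_bound psi c). nra.
Qed.

Lemma cos_sub_ge (psi y : R) : 0 <= y <= psi -> psi <= PI -> cos psi <= cos (psi - y).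
Proof. intros; apply cos_decr_1; lra. Qed.

(** The angle is the argument of [z] times the conjugate of [z + 1], which is [(r^2 + x) + i y] and
    has modulus [r s]; it lies in [[0, PI]] because [y >= 0]. *)
Lemma subtended_angle (x y r s : R) : 0 < r -> 0 < s ->
  r ^ 2 = x ^ 2 + y ^ 2 -> s ^ 2 = (1 + x) ^ 2 + y ^ 2 -> 0 <= y ->
  exists psi, 0 <= psi <= PI /\ cos psi = (r ^ 2 + x) / (r * s) /\ sin psi = y / (r * s).
Proof.
  intros Hr Hs Er Es Hy. set (v := (r ^ 2 + x) / (r * s)). set (S := y / (r * s)).
  assert (E : v ^ 2 + S ^ 2 = 1).
  { unfold v, S. replace (((r ^ 2 + x) / (r * s)) ^ 2 + (y / (r * s)) ^ 2)
      with ((r ^ 2 * r ^ 2 + 2 * r ^ 2 * x + (x ^ 2 + y ^ 2)) / (r ^ 2 * s ^ 2)) by (field; lra).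
    rewrite <- Er.
    replace (r ^ 2 * r ^ 2 + 2 * r ^ 2 * x + r ^ 2) with (r ^ 2 * s ^ 2) by nra.
    field; lra. }
  assert (HS : 0 <= S) by (apply Rdiv_le_0_compat; nra).
  assert (Hv : -1 <= v <= 1) by nra.
  exists (acos v). split; [apply acos_bound|]. split; [now apply cos_acos|].
  rewrite sin_acos by easy.
  replace (1 - v²) with (S ^ 2) by (unfold Rsqr; lra).
  now apply sqrt_pow2.
Qed.

(* For [z = x + i y]: [r = |z|], [s = |z + 1|], [psi = arg (z / (z + 1))] and
   [W = |1 / (z + 1) - z|^2 = |z zeta'(z) / zeta(z)|^2], while [arg (zeta z) = psi - y]. *)
Section Expansion.
Context (x y r s psi W : R).
Hypotheses (Hr : 0 < r) (Hs : 0 < s) (Hy : 0 <= y)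
  (Er : r ^ 2 = x ^ 2 + y ^ 2) (Es : s ^ 2 = (1 + x) ^ 2 + y ^ 2)
  (Hpsi : 0 <= psi <= PI)
  (Ec : cos psi = (r ^ 2 + x) / (r * s)) (Esin : sin psi = y / (r * s))
  (EW : W = r ^ 2 + (1 + 2 * y ^ 2 - 2 * x ^ 2 - 2 * x) / s ^ 2).

(** [T] is [(|zeta| - Re zeta) / |zeta|], so the squared ratio of the densities is
    [W (r - x) / (r T)]. Every lemma below bounds it from below by [1 + gain] on one region. *)
Let T := 1 - cos (psi - y).

Local Lemma T_bounds : 0 <= T <= 2.
Proof. unfold T; generalize (COS_bound (psi - y)); lra. Qed.

Local Lemma xr : - r <= x <= r. Proof. nra. Qed.

(** Here [T <= (y - psi)^2 / 2], while [W y^2 >= r^2 (y - psi)^2] and [y^2 = (r - x) (r + x)]; the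
    factor left over is [2 r / (r + x)], which exceeds 1 by at least [e / 2]. *)
Lemma expansion_far (e : R) : psi < y -> 0 <= e <= 1 -> x <= (1 - e) * r ->
  (1 + e / 2) * (r * T) <= W * (r - x).
Proof.
  intros H He Hx.
  assert (Hsin : sin psi <= psi).
  { destruct (proj1 Hpsi) as [h | <-]; [left; now apply sin_lt_x | rewrite sin_0; lra]. }
  assert (Hsin0 : 0 <= sin psi) by (rewrite Esin; apply Rdiv_le_0_compat; nra).
  assert (HT : T <= (y - psi) ^ 2 / 2).
  { unfold T. eapply Rle_trans; [apply one_minus_cos_le | nra]. }
  assert (HW : (y - psi) ^ 2 * r ^ 2 <= W * y ^ 2).
  (* Law of cosines for [y / (z + 1) - y z]: the two vectors have lengths [r sin psi] and [r y], and
     the cosine of their angle is the real part of [z (z + 1)] over its modulus. *)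
  { assert (E : W * y ^ 2 = r ^ 2 * ((y - sin psi) ^ 2
       + 2 * y * sin psi * (1 - (x ^ 2 - y ^ 2 + x) / (r * s)))).
    { rewrite EW, Esin. field; lra. }
    assert (HQ : (x ^ 2 - y ^ 2 + x) / (r * s) <= 1).
    { apply Rle_div_l; [nra|].
      assert ((x ^ 2 - y ^ 2 + x) ^ 2 <= (r * s) ^ 2).
      { replace ((r * s) ^ 2) with ((x^2+y^2) * ((1+x)^2+y^2)) by (rewrite <- Er, <- Es; ring).
        generalize (pow2_ge_0 (y * (2 * x + 1))); nra. }
      rewrite Rmult_1_l. assert (0 < r * s) by nra. nra. }
    rewrite E. assert (0 <= y * sin psi) by nra.
    assert ((y - psi) ^ 2 <= (y - sin psi) ^ 2) by nra.
    assert (0 <= y * sin psi * (1 - (x ^ 2 - y ^ 2 + x) / (r * s))) by (apply Rmult_le_pos; lra).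
    rewrite Rmult_comm. apply Rmult_le_compat_l; nra. }
  assert (Hrx : 0 < r + x).
  { assert (0 < y) by lra. destruct xr as [[h|h] _]; [lra|]. nra. }
  apply Rmult_le_reg_r with (r + x); [easy|].
  replace (W * (r - x) * (r + x)) with (W * y ^ 2)
    by (replace (y ^ 2) with (r ^ 2 - x ^ 2) by lra; ring).
  eapply Rle_trans; [|apply HW].
  assert (Hf : (1 + e / 2) * (r + x) <= 2 * r) by nra.
  destruct T_bounds as [T0 _].
  replace ((1 + e / 2) * (r * T) * (r + x)) with (r * T * ((1 + e / 2) * (r + x))) by ring.
  apply Rle_trans with (r * T * (2 * r)); [apply Rmult_le_compat_l; nra | nra].
Qed.

(** Since [0 <= cos psi <= cos (psi - y)], [T] is at most [sin psi ^ 2], hence at most [y^2 / s^2].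
    The imaginary part of [1 / (z + 1) - z] alone gives
    [W >= y^2 (1 + 1 / s^2)^2 >= 4 y^2 / s^2]. *)
Lemma expansion_left : x <= -1 -> y <= psi -> 2 * (r * T) <= W * (r - x).
Proof.
  intros Hx H.
  assert (HT : T <= y ^ 2 / s ^ 2).
  { assert (Hc : 0 <= cos psi) by (rewrite Ec; apply Rdiv_le_0_compat; nra).
    generalize (cos_sub_ge psi y); intros Hd.
    assert (E : (sin psi) ^ 2 = 1 - cos psi ^ 2) by (generalize (sin2_cos2 psi); unfold Rsqr; lra).
    apply Rle_trans with ((sin psi) ^ 2).
    - unfold T. assert (cos psi <= cos (psi - y)) by (apply Hd; lra).
      generalize (COS_bound psi); nra.
    - rewrite Esin. replace ((y / (r * s)) ^ 2) with (y ^ 2 / s ^ 2 * / r ^ 2) by (field; lra).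
      rewrite <- (Rmult_1_r (y ^ 2 / s ^ 2)) at 2. apply Rmult_le_compat_l.
      + apply Rdiv_le_0_compat; nra.
      + rewrite <- Rinv_1. apply Rinv_le_contravar; nra. }
  assert (HW : 4 * (y ^ 2 / s ^ 2) <= W).
  { assert (EW' : W = ((1 + x) / s ^ 2 - x) ^ 2 + y ^ 2 * (1 + / s ^ 2) ^ 2).
    { rewrite EW.
      replace (((1 + x) / s ^ 2 - x) ^ 2 + y ^ 2 * (1 + / s ^ 2) ^ 2)
        with (x ^ 2 + y ^ 2 + (((1 + x) ^ 2 + y ^ 2) / s ^ 2 + 2 * y ^ 2 - 2 * x * (1 + x)) / s ^ 2) by (field; lra).
      rewrite <- Er, <- Es. field. lra. }
    rewrite EW'. unfold Rdiv at 1.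
    generalize (pow2_ge_0 ((1 + x) / s ^ 2 - x)), (pow2_ge_0 (1 - / s ^ 2)), (pow2_ge_0 y). nra. }
  assert (0 <= T) by apply T_bounds.
  apply Rle_trans with (4 * T * r); [nra|].
  apply Rle_trans with (W * r); [apply Rmult_le_compat_r; lra|].
  apply Rmult_le_compat_l; lra.
Qed.

(** The trivial bounds [T <= 2] and [r - x >= r] suffice, because [W >= 2 + 1 / 4]; half of [9 / 4]
    is [1 + 1 / 8]. *)
Lemma expansion_middle : -1 <= x <= -1/2 -> (1 + / 8) * (r * T) <= W * (r - x).
Proof.
  intros Hx. destruct T_bounds as [T0 T2].
  assert (HW : 9 / 4 <= W).
  { rewrite EW. assert (2 <= (1 + 2 * y ^ 2 - 2 * x ^ 2 - 2 * x) / s ^ 2).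
    { apply Rle_div_r; nra. } nra. }
  apply Rle_trans with (9 / 4 * r); [nra|].
  apply Rmult_le_compat; lra.
Qed.

(** The gain of [expansion_right] is of order [y^2] and dies on the negative axis. Here [T <= 2] is
    nearly an equality and [r - x] is nearly [2 r], so the gain has to come from the first-order
    term of [W], and it is proportional to [- x]. *)
Lemma expansion_near_negative_axis : -1/2 <= x < 0 -> y <= x ^ 2 ->
  (1 - x) * (r * T) <= W * (r - x).
Proof.
  intros Hx Hyx. destruct T_bounds as [T0 T2].
  assert (Hs1 : s ^ 2 <= 1).
  { rewrite Es. assert (y ^ 2 <= x ^ 2 * x ^ 2) by nra.
    assert (x ^ 2 <= - x / 2) by nra. nra. }
  assert (HW : 1 - 5 / 2 * x <= W).
  { rewrite EW.
    assert (1 - 5 / 2 * x <= (1 + 2 * y ^ 2 - 2 * x ^ 2 - 2 * x) / s ^ 2); [|nra].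
    apply Rle_div_r; [nra|]. nra. }
  assert (Hrx : r <= - x * (1 + x ^ 2 / 2)).
  { apply Rsqr_incr_0_var; [|nra]. unfold Rsqr.
    assert (y ^ 2 <= x ^ 2 * x ^ 2) by nra.
    assert (0 <= x ^ 2 * x ^ 2 * x ^ 2) by nra. nra. }
  assert (r * (2 - x ^ 2 / 2) <= r - x) by nra.
  apply Rle_trans with ((1 - 5 / 2 * x) * (r * (2 - x ^ 2 / 2))).
  - replace ((1 - 5 / 2 * x) * (r * (2 - x ^ 2 / 2))) with (r * ((1 - 5 / 2 * x) * (2 - x ^ 2 / 2))) by ring.
    replace ((1 - x) * (r * T)) with (r * ((1 - x) * T)) by ring.
    apply Rmult_le_compat_l; [lra|].
    apply Rle_trans with ((1 - x) * 2); nra.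
  - apply Rmult_le_compat; nra.
Qed.

(** After division by [r^2] and use of [y^2 = (r - x) (r + x)], the claim compares [(1 + u) T] with
    [S^2 + y^2 - 2 y S Q], where [u], [c], [Q] are the cosines of the arguments of [z],
    [z / (z + 1)] and [z (z + 1)], with [Q <= u <= c]. *)
Lemma expansion_right (e d : R) : -1/2 <= x -> 0 < y <= psi -> 0 <= e <= 1 ->
  x <= (1 - e) * r -> 0 <= d <= e * y ^ 2 / 8 ->
  (1 + d) * (r * T) <= W * (r - x).
Proof.
  intros Hx Hyp He Hxe Hd. destruct T_bounds as [T0 T2].
  set (u := x / r). set (S := sin psi). set (c := cos psi).
  set (Q := (x ^ 2 - y ^ 2 + x) / (r * s)).
  assert (Hxu : x = u * r) by (unfold u; field; lra).
  assert (Hrs : 0 < r * s) by nra.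
  assert (HS : 0 <= S) by (unfold S; rewrite Esin; apply Rdiv_le_0_compat; lra).
  assert (E1 : S ^ 2 + c ^ 2 = 1) by (generalize (sin2_cos2 psi); unfold Rsqr, S, c; lra).
  assert (Hc1 : c <= 1) by (unfold c; apply COS_bound).
  assert (HT : T <= 1 - c - y * S + y ^ 2 / 2).
  { unfold T, c, S. generalize (cos_sub_taylor psi y); lra. }
  assert (Hrs1 : (s - 1) ^ 2 <= r ^ 2).
  { destruct (Rle_dec 0 (1 + x)); nra. }
  assert (Huc : u <= c).
  { unfold c. rewrite Ec. apply (Rle_div_r u _ (r * s)); [lra|]. unfold u.
    replace (x / r * (r * s)) with (x * s) by (field; lra).
    assert (x * (s - 1) <= r * r); [|nra].
    assert (Rabs (x * (s - 1)) <= r * r).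
    { rewrite Rabs_mult. apply Rmult_le_compat; try apply Rabs_pos.
      - apply Rabs_le; apply xr.
      - apply Rabs_le. split; nra. }
    generalize (Rle_abs (x * (s - 1))); lra. }
  assert (HQu : Q <= u).
  { unfold Q. apply (Rle_div_l _ _ (r * s)); [lra|]. unfold u.
    replace (x / r * (r * s)) with (x * s) by (field; lra).
    destruct (Rle_dec 0 x).
    - assert (1 + x <= s) by nra. nra.
    - assert (1 + x <= s) by nra.
      assert ((s - (1 + x)) * (s + (1 + x)) = y ^ 2) by nra. nra. }
  assert (Hu : u <= 1 - e) by (unfold u; apply Rle_div_l; lra).
  assert (Hu1 : -1 < u).
  { unfold u. apply Rlt_div_r; [lra|]. destruct xr as [[h|h] _]; nra. }
  (* With the Taylor bound for [T] and [S^2 = 1 - c^2], the difference splits into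
     [(1 - c) (c - u)], [y S (1 + u - 2 Q)] and [y^2 (1 - u) / 2]. The last one leaves the gain
     [e y^2 / 2]. *)
  assert (HG : (1 + u) * T + y ^ 2 * e / 2 <= S ^ 2 + y ^ 2 - 2 * y * S * Q).
  { assert (h1 : (1 + u) * T <= (1 + u) * (1 - c - y * S + y ^ 2 / 2)) by (apply Rmult_le_compat_l; lra).
    assert (h2 : 0 <= (1 - c) * (c - u)) by (apply Rmult_le_pos; lra).
    assert (h3 : 0 <= y * S * (1 + u - 2 * Q)) by (apply Rmult_le_pos; nra).
    assert (h4 : 0 <= y ^ 2 * (1 - u - e)) by (apply Rmult_le_pos; nra).
    nra. }
  assert (Hdd : d * ((1 + u) * T) <= y ^ 2 * e / 2).
  { apply Rle_trans with (d * 4); [|nra]. apply Rmult_le_compat_l; [lra|]. nra. }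
  assert (EWy : W * y ^ 2 = r ^ 2 * (S ^ 2 + y ^ 2 - 2 * y * S * Q)).
  { unfold S, Q. rewrite EW, Esin. field; lra. }
  assert (Hrx : 0 < r + x) by nra.
  apply Rmult_le_reg_r with (r + x); [easy|].
  replace (W * (r - x) * (r + x)) with (W * y ^ 2)
    by (replace (y ^ 2) with (r ^ 2 - x ^ 2) by lra; ring).
  rewrite EWy. replace ((1 + d) * (r * T) * (r + x)) with (r ^ 2 * ((1 + d) * ((1 + u) * T))) by (rewrite Hxu; ring).
  apply Rmult_le_compat_l; nra.
Qed.

(** The constant is a common lower bound of the gains of all regions. The power [r0^4] comes from
    the points above the parabola [y = x^2], where [y >= r0^2 / 2]; the second factor [e] comes from
    [x >= 0], where only [y^2 >= e r0^2] is available. *)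
Lemma expansion (e r0 : R) : 0 < y \/ x < 0 -> 0 <= e <= 1 -> 0 <= r0 <= 1 ->
  r0 <= r -> x <= (1 - e) * r ->
  (1 + r0 ^ 4 * e ^ 2 / 32) * (r * T) <= W * (r - x).
Proof.
  intros Hyx He Hr0 Hrr Hxe.
  set (d := r0 ^ 4 * e ^ 2 / 32).
  assert (HrT : 0 <= r * T) by (generalize T_bounds; nra).
  assert (He2 : 0 <= e ^ 2 <= e) by nra.
  assert (H02 : 0 <= r0 ^ 2 <= r0) by nra.
  assert (H04 : 0 <= r0 ^ 4 <= r0 ^ 2) by nra.
  assert (Hd0 : 0 <= d) by (unfold d; nra).
  assert (Hde : d <= e / 32) by (unfold d; nra).
  assert (Hdr : d <= r0 / 32) by (unfold d; nra).
  assert (mono : forall d', d <= d' -> (1 + d') * (r * T) <= W * (r - x) ->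
    (1 + d) * (r * T) <= W * (r - x)).
  { intros d' h h'. eapply Rle_trans; [|apply h']. apply Rmult_le_compat_r; lra. }
  destruct (Rlt_dec psi y) as [H|H].
  { apply mono with (e / 2); [lra|]. now apply expansion_far. }
  destruct (Rle_dec x (-1)) as [H1|H1].
  { apply mono with 1; [lra|]. replace (1 + 1) with 2 by ring. apply expansion_left; lra. }
  destruct (Rle_dec x (-1/2)) as [H2|H2].
  { apply mono with (/8); [lra|]. apply expansion_middle; lra. }
  (* Below the parabola [- x] is at least [r0 / 2], above it [y] is bounded below: one of the two
     gains is always available. *)
  destruct (Rlt_dec x 0) as [H3|H3]; [destruct (Rle_dec y (x ^ 2)) as [H4|H4]|].
  - apply mono with (- x).
    + assert (r0 ^ 2 <= 4 * x ^ 2).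
      { apply Rle_trans with (r ^ 2); [nra|]. assert (y ^ 2 <= x ^ 2 * x ^ 2) by nra.
        assert (x ^ 2 <= 1) by nra. nra. }
      nra.
    + replace (1 + - x) with (1 - x) by ring. apply expansion_near_negative_axis; lra.
  - apply expansion_right with e; try lra; [nra|]. split; [easy|].
    assert (Hyr : r0 ^ 2 / 2 <= y).
    { destruct (Rle_dec (r0 ^ 2 / 2) y); [easy|]. exfalso.
      assert (r0 ^ 2 <= r ^ 2) by nra. assert (y ^ 2 <= r0 ^ 2 / 4) by nra. nra. }
    unfold d. assert (r0 ^ 4 / 4 <= y ^ 2) by nra.
    apply Rle_trans with (r0 ^ 4 * e / 32); nra.
  - apply expansion_right with e; try lra. split; [easy|].
    assert (Hyr : e * r0 ^ 2 <= y ^ 2).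
    { assert (x ^ 2 <= (1 - e) ^ 2 * r ^ 2) by nra.
      assert (r0 ^ 2 <= r ^ 2) by nra. nra. }
    unfold d. apply Rle_trans with (e * (e * r0 ^ 2) / 8); nra.
Qed.

End Expansion.

(** * Real dynamics *)

Definition zetaR (lam x : R) : R := lam * (x / (x + 1)) * exp (- x).

Lemma zetaR_derive (lam x : R) : x + 1 <> 0 ->
  is_derive (zetaR lam) x (lam * exp (- x) * (1 - x - x ^ 2) / (x + 1) ^ 2).
Proof. intros Hx. unfold zetaR. auto_derive; [easy|]. field; easy. Qed.

Lemma zetaR_continuous (lam x : R) : 0 < x -> continuity_pt (zetaR lam) x.
Proof.
  intros Hx. apply derivable_continuous_pt. eexists.
  apply is_derive_Reals, zetaR_derive. lra.
Qed.

Lemma zetaR_pos (lam x : R) : 0 < lam -> 0 < x -> 0 < zetaR lam x.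
Proof.
  intros; unfold zetaR. apply Rmult_lt_0_compat; [|apply exp_pos].
  apply Rmult_lt_0_compat; [easy|]. apply Rdiv_lt_0_compat; lra.
Qed.

(** The condition [t^2 + t <= 1] places [t] to the left of the only positive critical point, the
    positive root of [x^2 + x = 1]. *)
Lemma zetaR_increasing (lam s t : R) : 0 < lam -> 0 < s <= t -> t ^ 2 + t <= 1 ->
  zetaR lam s <= zetaR lam t.
Proof.
  intros Hl [Hs [Hst| ->]] Ht; [|lra].
  destruct (MVT_cor2 (zetaR lam) (fun x => lam * exp (- x) * (1 - x - x ^ 2) / (x + 1) ^ 2)
    s t Hst) as (c & Hc & Hcst).
  { intros; apply is_derive_Reals, zetaR_derive; lra. }
  assert (0 <= lam * exp (- c) * (1 - c - c ^ 2) / (c + 1) ^ 2); [|nra].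
  apply Rdiv_le_0_compat; [|nra]. apply Rmult_le_pos; [|nra].
  generalize (exp_pos (- c)); nra.
Qed.

Lemma zetaR_decreasing (lam s t : R) : 0 < lam -> 0 < s <= t -> 1 <= s ^ 2 + s ->
  zetaR lam t <= zetaR lam s.
Proof.
  intros Hl [Hs [Hst| ->]] Ht; [|lra].
  destruct (MVT_cor2 (zetaR lam) (fun x => lam * exp (- x) * (1 - x - x ^ 2) / (x + 1) ^ 2)
    s t Hst) as (c & Hc & Hcst).
  { intros; apply is_derive_Reals, zetaR_derive; lra. }
  assert (0 <= lam * exp (- c) * (c ^ 2 + c - 1) / (c + 1) ^ 2).
  { apply Rdiv_le_0_compat; [|nra]. apply Rmult_le_pos; [|nra].
    generalize (exp_pos (- c)); nra. }
  replace (lam * exp (- c) * (1 - c - c ^ 2) / (c + 1) ^ 2) with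
    (- (lam * exp (- c) * (c ^ 2 + c - 1) / (c + 1) ^ 2)) in Hc by (field; lra).
  nra.
Qed.

(* [x * zetaR lam x = lam * exp (ldiff x)], so [zetaR lam (zetaR lam x) > x]
   amounts to [ldiff (zetaR lam x) > ldiff x]. *)
Definition ldiff (t : R) : R := 2 * ln t - ln (1 + t) - t.

Lemma ldiff_derive (t : R) : 0 < t -> is_derive ldiff t ((2 - t ^ 2) / (t * (1 + t))).
Proof. intros. unfold ldiff. auto_derive; [lra|]. field; lra. Qed.

Lemma zetaR_ldiff (lam t : R) : 0 < t -> t * zetaR lam t = lam * exp (ldiff t).
Proof.
  intros Ht. unfold ldiff, zetaR.
  replace (2 * ln t - ln (1 + t) - t) with (ln t + ln t + - ln (1 + t) + - t) by ring.
  rewrite !exp_plus, (exp_Ropp (ln (1 + t))), !exp_ln by lra. field. lra.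
Qed.

Lemma sqrt2_sq : sqrt 2 * sqrt 2 = 2. Proof. apply sqrt_sqrt; lra. Qed.
Lemma sqrt2_gt1 : 1 < sqrt 2.
Proof. rewrite <- sqrt_1. apply sqrt_lt_1; lra. Qed.

Lemma ldiff_incr (s t : R) : 0 < s < t -> t <= sqrt 2 -> ldiff s < ldiff t.
Proof.
  intros [Hs Hst] Ht.
  destruct (MVT_cor2 ldiff (fun t => (2 - t ^ 2) / (t * (1 + t))) s t Hst) as (c & Hc & Hcst).
  { intros; apply is_derive_Reals, ldiff_derive; lra. }
  assert (0 < (2 - c ^ 2) / (c * (1 + c))); [|nra].
  apply Rdiv_lt_0_compat; [generalize sqrt2_sq|]; nra.
Qed.

Lemma ldiff_decr (s t : R) : sqrt 2 <= s < t -> ldiff t < ldiff s.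
Proof.
  intros [Hs Hst]. generalize sqrt2_sq sqrt2_gt1; intros h1 h2.
  destruct (MVT_cor2 ldiff (fun t => (2 - t ^ 2) / (t * (1 + t))) s t Hst) as (c & Hc & Hcst).
  { intros; apply is_derive_Reals, ldiff_derive; lra. }
  assert (0 < (c ^ 2 - 2) / (c * (1 + c))) by (apply Rdiv_lt_0_compat; nra).
  replace ((2 - c ^ 2) / (c * (1 + c))) with (- ((c ^ 2 - 2) / (c * (1 + c)))) in Hc by (field; lra).
  nra.
Qed.

Definition lam_star : R := (sqrt 2 + 1) * exp (sqrt 2).

Lemma lam_star_pos : 0 < lam_star.
Proof. unfold lam_star. generalize sqrt2_gt1 (exp_pos (sqrt 2)); nra. Qed.

Lemma zetaR_lam_star_sqrt2 : zetaR lam_star (sqrt 2) = sqrt 2.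
Proof.
  unfold zetaR, lam_star. rewrite exp_Ropp. generalize sqrt2_gt1 (exp_pos (sqrt 2)); intros.
  field. lra.
Qed.

(** The difference of the two sides vanishes at the fixed point [sqrt 2], and it is monotone on
    [[x, sqrt 2]] in the direction that gives the claim. *)
Lemma ldiff_zetaR_lam_star (x : R) : 0 < x <= sqrt 2 -> 1 <= x ^ 2 + x ->
  ldiff x <= ldiff (zetaR lam_star x).
Proof.
  intros [Hx [Hx2| ->]] H1; [|rewrite zetaR_lam_star_sqrt2; lra].
  generalize sqrt2_sq sqrt2_gt1 lam_star_pos; intros h1 h2 h3.
  destruct (MVT_cor2 (fun t => ldiff (zetaR lam_star t) - ldiff t)
     (fun t => let Y := zetaR lam_star t in
        ((2 - Y ^ 2) / (Y * (1 + Y))) * (lam_star * exp (- t) * (1 - t - t ^ 2) / (t + 1) ^ 2)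
        - (2 - t ^ 2) / (t * (1 + t))) x (sqrt 2) Hx2) as (c & Hc & Hcst).
  { intros t Ht. apply is_derive_Reals. cbv zeta.
    apply (is_derive_minus (V := R_NormedModule)); [|apply ldiff_derive; lra].
    rewrite Rmult_comm. apply (is_derive_comp ldiff (zetaR lam_star)).
    - apply ldiff_derive, zetaR_pos; lra.
    - apply zetaR_derive; lra. }
  cbv zeta in Hc. rewrite zetaR_lam_star_sqrt2 in Hc.
  set (Y := zetaR lam_star c) in *.
  assert (HY : sqrt 2 <= Y).
  { rewrite <- zetaR_lam_star_sqrt2 at 1. apply zetaR_decreasing; nra. }
  (* [c * Y <= 2] because [ldiff] is maximal at [sqrt 2] *)
  assert (HcY : c * Y <= 2).
  { unfold Y. rewrite zetaR_ldiff by lra.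
    rewrite <- sqrt2_sq. rewrite <- zetaR_lam_star_sqrt2 at 2. rewrite zetaR_ldiff by lra.
    apply Rmult_le_compat_l; [lra|]. left. apply exp_increasing, ldiff_incr; lra. }
  (* The definition of [Y] expresses [lam_star exp (- c)] through [Y] and [c], which makes the
     derivative rational. *)
  assert (HD : (2 - Y ^ 2) / (Y * (1 + Y)) * (lam_star * exp (- c) * (1 - c - c ^ 2) / (c + 1) ^ 2)
     - (2 - c ^ 2) / (c * (1 + c)) =
     ((Y ^ 2 - 2) * (c ^ 2 + c - 1) - (2 - c ^ 2) * (1 + Y)) / ((1 + Y) * (c * (1 + c)))).
  { assert (E : lam_star * exp (- c) = Y * (1 + c) / c).
    { unfold Y, zetaR. field. lra. }
    rewrite E. field. lra. }
  rewrite HD in Hc.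
  assert (Hnum : (Y ^ 2 - 2) * (c ^ 2 + c - 1) <= (2 - c ^ 2) * (1 + Y)).
  { assert (hY : 0 <= Y ^ 2 - 2) by nra.
    assert (hc : 0 < 2 - c ^ 2) by nra.
    apply Rmult_le_reg_l with 2; [lra|].
    apply Rle_trans with ((Y ^ 2 - 2) * (c * (c + 2))).
    - replace (2 * ((Y ^ 2 - 2) * (c ^ 2 + c - 1))) with ((Y ^ 2 - 2) * (2 * (c ^ 2 + c - 1))) by ring.
      apply Rmult_le_compat_l; nra.
    (* This product equals [2 (2 - c^2) (1 + Y) - (Y^2 - 2) c (c + 2)]. *)
    - assert (0 <= (2 - c * Y) * (c * Y + 2 * c + 2 * Y + 2)) by (apply Rmult_le_pos; nra).
      nra. }
  assert (Hneg : ((Y ^ 2 - 2) * (c ^ 2 + c - 1) - (2 - c ^ 2) * (1 + Y)) / ((1 + Y) * (c * (1 + c))) <= 0).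
  { apply Rle_div_l; [|lra]. apply Rmult_lt_0_compat; nra. }
  nra.
Qed.

(** * Orbits of monotone interval maps *)

Lemma monotone_orbit_limit (T : R -> R) (l u x : R) :
  (forall t, l <= t <= u -> continuity_pt T t) ->
  (forall n, l <= Nat.iter n T x <= u) ->
  (forall n, Nat.iter n T x <= Nat.iter (S n) T x) \/
  (forall n, Nat.iter (S n) T x <= Nat.iter n T x) ->
  exists p, l <= p <= u /\ T p = p /\ is_lim_seq (fun n => Nat.iter n T x) p.
Proof.
  intros HT Hb Hm.
  assert (Hl : ex_finite_lim_seq (fun n => Nat.iter n T x)).
  { destruct Hm as [Hm|Hm].
    - apply ex_finite_lim_seq_incr with u; [easy | apply Hb].
    - apply ex_finite_lim_seq_decr with l; [easy | apply Hb]. }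
  destruct Hl as [p Hp]. exists p.
  assert (Hpb : l <= p <= u).
  { split.
    - apply (is_lim_seq_le (fun _ => l) (fun n => Nat.iter n T x) l p); [apply Hb | apply is_lim_seq_const | easy].
    - apply (is_lim_seq_le (fun n => Nat.iter n T x) (fun _ => u) p u); [apply Hb | easy | apply is_lim_seq_const]. }
  split; [easy|]. split; [|easy].
  assert (H1 : is_lim_seq (fun n => Nat.iter (S n) T x) (T p)).
  { simpl. apply is_lim_seq_continuous; auto. }
  apply (is_lim_seq_incr_1 (fun n => Nat.iter n T x)) in Hp.
  apply is_lim_seq_unique in Hp. apply is_lim_seq_unique in H1.
  rewrite Hp in H1. now injection H1.
Qed.

Lemma iter_in (T : R -> R) (l u x : R) : (forall t, l <= t <= u -> l <= T t <= u) ->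
  l <= x <= u -> forall n, l <= Nat.iter n T x <= u.
Proof. intros HT Hx n. induction n as [|n IH]; simpl; auto. Qed.

Lemma monotone_map_cv (T : R -> R) (l u p x : R) :
  (forall t, l <= t <= u -> continuity_pt T t) ->
  (forall s t, l <= s <= t -> t <= u -> T s <= T t) ->
  (forall t, l <= t <= u -> l <= T t <= u) ->
  (forall q, l <= q <= u -> T q = q -> q = p) ->
  l <= x <= u -> is_lim_seq (fun n => Nat.iter n T x) p.
Proof.
  intros HT Hinc Hin Hp Hx.
  generalize (iter_in T l u x Hin Hx); intros Hb.
  destruct (monotone_orbit_limit T l u x HT Hb) as (q & Hq & Hfix & Hl).
  - destruct (Rle_dec x (T x)) as [H|H]; [left|right]; intros n;
      induction n as [|n IH]; simpl in *; try lra.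
    + apply Hinc; [|apply (Hb (S n))]. split; [apply Hb | easy].
    + apply Hinc; [|apply Hb]. split; [apply (Hb (S n)) | easy].
  - now rewrite (Hp q) in Hl.
Qed.

Lemma iter_double (T : R -> R) (n : nat) (x : R) :
  Nat.iter n (fun t => T (T t)) x = Nat.iter (2 * n) T x.
Proof.
  induction n as [|n IH]; [easy|]. replace (2 * S n)%nat with (S (S (2 * n))) by lia.
  simpl in *. now rewrite IH.
Qed.

Lemma is_lim_seq_even_odd (u : nat -> R) (l : R) :
  is_lim_seq (fun n => u (2 * n)%nat) l -> is_lim_seq (fun n => u (S (2 * n))) l ->
  is_lim_seq u l.
Proof.
  intros H0 H1. apply is_lim_seq_spec in H0, H1. apply is_lim_seq_spec. intros eps.
  destruct (H0 eps) as [N0 HN0]. destruct (H1 eps) as [N1 HN1].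
  exists (2 * N0 + 2 * N1 + 1)%nat. intros n Hn.
  destruct (Nat.Even_or_Odd n) as [[k ->]|[k ->]].
  - apply HN0; lia.
  - replace (2 * k + 1)%nat with (S (2 * k)) by lia. apply HN1; lia.
Qed.

Lemma is_lim_seq_shift_orbit (T : R -> R) (m : nat) (x p : R) :
  is_lim_seq (fun n => Nat.iter n T (Nat.iter m T x)) p -> is_lim_seq (fun n => Nat.iter n T x) p.
Proof.
  intros H. apply (is_lim_seq_incr_n _ m).
  eapply is_lim_seq_ext; [|apply H]. intros n; simpl. now rewrite Nat.iter_add.
Qed.

Section RealDynamics.
Context (lam a : R).
Hypotheses (Ha : 0 < a) (Ha2 : a < sqrt 2) (Elam : lam = (a + 1) * exp a).

Local Notation g := (zetaR lam).

Local Lemma lam_pos : 0 < lam.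
Proof. rewrite Elam. generalize (exp_pos a); nra. Qed.

Local Lemma lam_lt : lam < lam_star.
Proof.
  rewrite Elam. unfold lam_star. generalize (exp_increasing a (sqrt 2) Ha2) (exp_pos a); nra.
Qed.

Lemma zetaR_fixed : g a = a.
Proof. rewrite Elam. unfold zetaR. rewrite exp_Ropp. generalize (exp_pos a); intros. field. lra. Qed.

Lemma zetaR_above (x : R) : 0 < x < a -> x < g x.
Proof.
  intros Hx. unfold zetaR. rewrite Elam, exp_Ropp.
  assert (He : exp x < exp a) by (apply exp_increasing; lra).
  generalize (exp_pos x); intros Hp.
  replace ((a + 1) * exp a * (x / (x + 1)) * / exp x) with
    (x * ((a + 1) * exp a / ((x + 1) * exp x))) by (field; lra).
  rewrite <- (Rmult_1_r x) at 1. apply Rmult_lt_compat_l; [lra|].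
  apply Rlt_div_r; nra.
Qed.

Lemma zetaR_below (x : R) : a < x -> g x < x.
Proof.
  intros Hx. unfold zetaR. rewrite Elam, exp_Ropp.
  assert (He : exp a < exp x) by (apply exp_increasing; lra).
  generalize (exp_pos x) (exp_pos a); intros Hp Hp'.
  replace ((a + 1) * exp a * (x / (x + 1)) * / exp x) with
    (x * ((a + 1) * exp a / ((x + 1) * exp x))) by (field; lra).
  rewrite <- (Rmult_1_r x) at 4. apply Rmult_lt_compat_l; [lra|].
  apply Rlt_div_l; nra.
Qed.

Lemma zetaR_fixed_unique (x : R) : 0 < x -> g x = x -> x = a.
Proof.
  intros Hx E. destruct (Rtotal_order x a) as [H|[H|H]]; [|easy|].
  - generalize (zetaR_above x); lra.
  - generalize (zetaR_below x); lra.
Qed.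

(** This excludes 2-cycles. If [g x <= sqrt 2], then [ldiff] increases from [x] to [g x]. Otherwise
    [g x] lies beyond [sqrt 2] and below its value for [lam_star]; [ldiff] decreases there, so the
    claim follows from the case of [lam_star]. *)
Lemma zetaR_two_step (x : R) : 0 < x < a -> 1 <= x ^ 2 + x -> x < g (g x).
Proof.
  intros Hx H1. generalize lam_pos lam_lt; intros Hl Hls.
  assert (Hya : a <= g x).
  { rewrite <- zetaR_fixed at 1. apply zetaR_decreasing; lra. }
  set (y := g x) in *.
  assert (HD : ldiff x < ldiff y).
  { destruct (Rle_dec y (sqrt 2)) as [Hy|Hy]; [apply ldiff_incr; lra|].
    apply Rle_lt_trans with (ldiff (zetaR lam_star x)); [apply ldiff_zetaR_lam_star; lra|].
    apply ldiff_decr. split; [lra|]. unfold y, zetaR.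
    apply Rmult_lt_compat_r; [apply exp_pos|]. apply Rmult_lt_compat_r; [|easy].
    apply Rdiv_lt_0_compat; lra. }
  apply Rmult_lt_reg_l with y; [lra|]. rewrite (zetaR_ldiff lam y) by lra.
  rewrite (Rmult_comm y x). unfold y. rewrite zetaR_ldiff by lra.
  apply Rmult_lt_compat_l; [easy|]. now apply exp_increasing.
Qed.

(** Let [c] be the critical point. If [a <= c], every orbit enters [(0, c]] after one step, and [g]
    is increasing there. If [c < a], orbits end up in [[c, g c]], where [g] decreases and [g]
    composed with itself increases with [a] as its only fixed point. *)
Lemma zetaR_orbit_cv (x : R) : 0 < x -> is_lim_seq (fun n => Nat.iter n g x) a.
Proof.
  intros Hx. generalize lam_pos; intros Hl.
  set (c := (sqrt 5 - 1) / 2).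
  assert (H5 : sqrt 5 * sqrt 5 = 5) by (apply sqrt_sqrt; lra).
  assert (H5' : 1 < sqrt 5) by (rewrite <- sqrt_1; apply sqrt_lt_1; lra).
  assert (Ec : c ^ 2 + c = 1) by (unfold c; nra).
  assert (Hc : 0 < c) by (unfold c; lra).
  assert (Hmax : forall t, 0 < t -> g t <= g c).
  { intros t Ht. destruct (Rle_dec t c).
    - apply zetaR_increasing; lra.
    - apply zetaR_decreasing; lra. }
  destruct (Rle_dec a c) as [Hac|Hac].
  - assert (Hgc : g c <= c).
    { destruct Hac as [Hac| <-]; [left; now apply zetaR_below | rewrite zetaR_fixed; lra]. }
    assert (H0 : forall t, 0 < t <= c -> is_lim_seq (fun n => Nat.iter n g t) a).
    { intros t Ht. assert (Hm : 0 < Rmin t a) by (apply Rmin_pos; lra).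
      apply monotone_map_cv with (l := Rmin t a) (u := c).
      - intros s Hs. apply zetaR_continuous. lra.
      - intros s s' Hs Hs'. apply zetaR_increasing; [easy | lra |].
        assert (0 < s') by lra. nra.
      - intros s Hs. split; [|apply Rle_trans with (g c); [apply Hmax; lra | easy]].
        apply Rle_trans with (g (Rmin t a)); [|apply zetaR_increasing; nra].
        destruct (Rmin_r t a) as [h|h]; [left; apply zetaR_above; lra|].
        rewrite h, zetaR_fixed; lra.
      - intros q Hq. apply zetaR_fixed_unique. lra.
      - split; [apply Rmin_l | lra]. }
    apply (is_lim_seq_shift_orbit g 1). simpl. apply H0. split; [now apply zetaR_pos|].
    apply Rle_trans with (g c); auto.
  - apply Rnot_le_lt in Hac. set (M := g c).
    (* Applied at the critical point, the two-step estimate makes [[c, M]] invariant. *)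
    assert (HgM : c < g M) by (apply zetaR_two_step; lra).
    assert (HMa : a <= M).
    { rewrite <- zetaR_fixed. apply Hmax; easy. }
    assert (Hin : forall t, c <= t <= M -> c <= g t <= M).
    { intros t Ht. split; [|apply Hmax; lra].
      apply Rle_trans with (g M); [lra|]. apply zetaR_decreasing; nra. }
    assert (H0 : forall t, c <= t <= M -> is_lim_seq (fun n => Nat.iter (2 * n) g t) a).
    { intros t Ht. eapply is_lim_seq_ext; [intros n; apply iter_double|].
      apply monotone_map_cv with (l := c) (u := M).
      - intros s Hs. apply (continuity_pt_comp g g); apply zetaR_continuous; [lra|].
        apply zetaR_pos; lra.
      - intros s s' Hs Hs'. apply zetaR_decreasing; [easy| |].
        + split; [apply zetaR_pos; lra|]. apply zetaR_decreasing; nra.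
        + assert (c <= g s') by (apply Hin; lra). nra.
      - intros s Hs. auto.
      - intros q Hq Eq. destruct (Rtotal_order q a) as [H|[H|H]]; [|easy|].
        + assert (q < g (g q)) by (apply zetaR_two_step; nra). lra.
        + assert (Hg : c <= g q) by (apply Hin; lra).
          assert (Hga : g q <= a).
          { rewrite <- zetaR_fixed. apply zetaR_decreasing; nra. }
          destruct Hga as [Hga|Hga].
          * assert (H2 : g q < g (g (g q))) by (apply zetaR_two_step; nra). rewrite Eq in H2. lra.
          * rewrite Hga, zetaR_fixed in Eq. lra.
      - easy. }
    assert (H1 : forall t, c <= t <= M -> is_lim_seq (fun n => Nat.iter n g t) a).
    { intros t Ht. apply is_lim_seq_even_odd; [now apply H0|].
      eapply is_lim_seq_ext; [intros n; symmetry; apply Nat.iter_succ_r|]. apply H0, Hin, Ht. }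
    (* An orbit that stayed below [c] would increase to a fixed point at most [c], hence below
       [a]. *)
    assert (H2 : exists n, c <= Nat.iter n g (g x)).
    { apply Classical_Prop.NNPP. intros Hn.
      assert (Hn' : forall n, Nat.iter n g (g x) < c).
      { intros n. apply Rnot_le_lt. intros h. apply Hn. now exists n. }
      assert (Hpos : forall n, 0 < Nat.iter n g (g x)).
      { intros n. induction n; simpl; now apply zetaR_pos. }
      assert (Hincr : forall n, Nat.iter n g (g x) <= Nat.iter (S n) g (g x)).
      { intros n. simpl. left. apply zetaR_above. split; [easy|]. specialize (Hn' n); lra. }
      assert (Hlow : forall n, g x <= Nat.iter n g (g x)).
      { intros n. induction n as [|n IH]; [simpl; lra|]. eapply Rle_trans; [apply IH | apply Hincr]. }
      destruct (monotone_orbit_limit g (g x) c (g x)) as (p & Hp & Hfix & _).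
      - intros t Ht. apply zetaR_continuous. specialize (Hpos O); simpl in Hpos; lra.
      - intros n. split; [apply Hlow | left; apply Hn'].
      - now left.
      - specialize (Hpos O); simpl in Hpos.
        assert (p = a) by (apply zetaR_fixed_unique; lra). lra. }
    destruct H2 as [n Hn]. rewrite <- Nat.iter_succ_r in Hn.
    apply (is_lim_seq_shift_orbit g (S n)). apply H1. split; [easy|].
    simpl. apply Hmax. clear Hn. induction n as [|n IH]; simpl; [easy | now apply zetaR_pos].
Qed.

End RealDynamics.

(** * Complex differentiability *)

Lemma C_ext (z w : C) : fst z = fst w -> snd z = snd w -> z = w.
Proof. destruct z, w; simpl; now intros -> ->. Qed.

Lemma Cmod_sq (z : C) : Cmod z ^ 2 = fst z ^ 2 + snd z ^ 2.
Proof. unfold Cmod. rewrite pow2_sqrt; [easy|]. nra. Qed.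

Lemma fst_le_Cmod (z : C) : - Cmod z <= fst z <= Cmod z.
Proof. generalize (Cmod_sq z) (Cmod_ge_0 z); nra. Qed.

Lemma snd_le_Cmod (z : C) : - Cmod z <= snd z <= Cmod z.
Proof. generalize (Cmod_sq z) (Cmod_ge_0 z); nra. Qed.

Lemma Cmod_le_sum (z : C) : Cmod z <= Rabs (fst z) + Rabs (snd z).
Proof.
  apply Rsqr_incr_0_var.
  - generalize (Cmod_sq z) (Rabs_pos (fst z)) (Rabs_pos (snd z)) (pow2_abs (fst z)) (pow2_abs (snd z)).
    unfold Rsqr; nra.
  - generalize (Rabs_pos (fst z)) (Rabs_pos (snd z)); lra.
Qed.

(** Stated by coordinates, so that the facts about real continuity and integration apply to each of
    them directly. *)
Definition ccont {U : UniformSpace} (f : U -> C) (x : U) : Prop :=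
  continuous (fun w => fst (f w)) x /\ continuous (fun w => snd (f w)) x.

Lemma continuous_pow2 {U : UniformSpace} (f : U -> R) (x : U) :
  continuous f x -> continuous (fun w => f w ^ 2) x.
Proof.
  intros H. apply (continuous_ext (fun w => f w * f w)); [intros; simpl; ring|].
  now apply (continuous_mult (K := R_AbsRing)).
Qed.

Lemma continuous_sqrt_comp {U : UniformSpace} (f : U -> R) (x : U) :
  continuous f x -> continuous (fun w => sqrt (f w)) x.
Proof. intros H. apply (continuous_comp f sqrt); [easy | apply continuous_sqrt]. Qed.

Lemma continuous_Rdiv {U : UniformSpace} (f g : U -> R) (x : U) :
  continuous f x -> continuous g x -> g x <> 0 -> continuous (fun w => f w / g w) x.
Proof.
  intros Hf Hg H. apply (continuous_mult (K := R_AbsRing)); [easy|].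
  apply (continuous_comp g Rinv); [easy | now apply continuous_Rinv].
Qed.

Section Continuity.
Context {U : UniformSpace}.
Implicit Types (f g : U -> C) (x : U).

Lemma ccont_const (c : C) x : ccont (fun _ => c) x.
Proof. split; apply continuous_const. Qed.

Lemma ccont_plus f g x : ccont f x -> ccont g x -> ccont (fun w => f w + g w)%C x.
Proof. intros [f1 f2] [g1 g2]. split; now apply (continuous_plus (V := R_NormedModule)). Qed.

Lemma ccont_opp f x : ccont f x -> ccont (fun w => - f w)%C x.
Proof. intros [f1 f2]. split; now apply (continuous_opp (V := R_NormedModule)). Qed.

Lemma ccont_minus f g x : ccont f x -> ccont g x -> ccont (fun w => f w - g w)%C x.
Proof. intros. apply ccont_plus; [|apply ccont_opp]; easy. Qed.

Lemma ccont_mult f g x : ccont f x -> ccont g x -> ccont (fun w => f w * g w)%C x.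
Proof.
  intros [f1 f2] [g1 g2]. split; simpl;
  [apply (continuous_minus (V := R_NormedModule)) | apply (continuous_plus (V := R_NormedModule))];
  now apply (continuous_mult (K := R_AbsRing)).
Qed.

Lemma ccont_inv f x : ccont f x -> f x <> 0 -> ccont (fun w => / f w)%C x.
Proof.
  intros [f1 f2] H.
  assert (H' : fst (f x) ^ 2 + snd (f x) ^ 2 <> 0).
  { intros E. apply H. apply C_ext; simpl; nra. }
  split; simpl; apply continuous_Rdiv; try easy;
  try (apply (continuous_plus (V := R_NormedModule)); now apply continuous_pow2);
  now apply (continuous_opp (V := R_NormedModule)).
Qed.

Lemma ccont_Cmod f x : ccont f x -> continuous (fun w => Cmod (f w)) x.
Proof.
  intros [f1 f2]. apply continuous_sqrt_comp, (continuous_plus (V := R_NormedModule));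
  now apply continuous_pow2.
Qed.

Lemma ccont_continuous f x : ccont f x -> continuous (f : U -> C_UniformSpace) x.
Proof.
  intros [f1 f2]. apply filterlim_locally. intros eps.
  assert (h1 := proj1 (filterlim_locally _ _) f1 eps).
  assert (h2 := proj1 (filterlim_locally _ _) f2 eps).
  generalize (filter_and _ _ h1 h2). apply filter_imp. intros w [a b]. now split.
Qed.

Lemma ccont_ext_loc f g x : locally x (fun w => g w = f w) -> ccont g x -> ccont f x.
Proof.
  intros H [g1 g2].
  split; [apply (continuous_ext_loc _ _ _) with (2 := g1) | apply (continuous_ext_loc _ _ _) with (2 := g2)];
  revert H; apply filter_imp; now intros w ->.
Qed.

Lemma ccont_comp (h : C -> C) f x : ccont h (f x : C_UniformSpace) -> ccont f x ->
  ccont (fun w => h (f w)) x.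
Proof.
  intros [h1 h2] Hf%ccont_continuous. split.
  - now apply (continuous_comp (V := C_UniformSpace) f (fun z => fst (h z))).
  - now apply (continuous_comp (V := C_UniformSpace) f (fun z => snd (h z))).
Qed.
End Continuity.

Ltac ccont_auto :=
  repeat match goal with
  | |- ccont (fun _ => ?c) _ => exact (ccont_const c _)
  | |- ccont _ _ => assumption
  | |- ccont (fun w => Cplus _ _) _ => apply ccont_plus
  | |- ccont (fun w => Cminus _ _) _ => apply ccont_minus
  | |- ccont (fun w => Cmult _ _) _ => apply ccont_mult
  | |- ccont (fun w => Cdiv _ _) _ => apply ccont_mult
  | |- ccont (fun w => Copp _) _ => apply ccont_opp
  | |- ccont (fun w => Cinv _) _ => apply ccont_inv
  | |- ccont (Cminus ?c) _ => apply (ccont_minus (fun _ => c) (fun w => w))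
  | |- ccont Cinv _ => apply (ccont_inv (fun w => w))
  end.

Lemma ccont_id (z : C_UniformSpace) : ccont (fun w => w) z.
Proof. destruct z; split; [apply continuous_fst | apply continuous_snd]. Qed.

Lemma locally_C_Cmod (z : C_UniformSpace) (P : C -> Prop) :
  locally z P <-> exists d, 0 < d /\ forall w, Cmod (w - z)%C < d -> P w.
Proof.
  split.
  - intros [d Hd]. exists d. split; [apply cond_pos|]. intros w Hw. apply Hd.
    generalize (fst_le_Cmod (w - z)%C) (snd_le_Cmod (w - z)%C); intros h1 h2.
    destruct z, w; split; apply Rabs_def1; unfold minus, plus, opp; simpl in *; lra.
  - intros (d & Hd & H). assert (Hd2 : 0 < d / 2) by lra. exists (mkposreal _ Hd2). intros w [h1 h2].
    apply H. eapply Rle_lt_trans; [apply Cmod_le_sum|].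
    destruct z, w. unfold ball in *; simpl in *. unfold AbsRing_ball, abs, minus, plus, opp in *; simpl in *. lra.
Qed.

Lemma ccont_eps (f : C -> C) (z : C_UniformSpace) : ccont f z <->
  forall eps, 0 < eps -> exists d, 0 < d /\ forall w, Cmod (w - z)%C < d -> Cmod (f w - f z)%C < eps.
Proof.
  split.
  - intros Hf eps Heps. apply locally_C_Cmod.
    apply ccont_continuous in Hf.
    apply (Hf (fun v => Cmod (v - f z)%C < eps)). apply locally_C_Cmod. now exists eps.
  - intros H. split; apply filterlim_locally; intros [eps Heps];
    destruct (H eps Heps) as (d & Hd & Hw); apply locally_C_Cmod; exists d; (split; [easy|]);
    intros w h; specialize (Hw w h).
    + generalize (fst_le_Cmod (f w - f z)%C). intros; apply Rabs_def1; unfold minus, plus, opp; simpl in *; lra.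
    + generalize (snd_le_Cmod (f w - f z)%C). intros; apply Rabs_def1; unfold minus, plus, opp; simpl in *; lra.
Qed.

(* Caratheodory's formulation of complex differentiability. *)
Definition cderiv (f : C -> C) (z l : C) : Prop :=
  exists phi : C -> C, ccont phi (z : C_UniformSpace) /\ phi z = l /\
    locally (z : C_UniformSpace) (fun w => f w - f z = phi w * (w - z))%C.

Lemma cderiv_ccont (f : C -> C) (z l : C) : cderiv f z l -> ccont f (z : C_UniformSpace).
Proof.
  intros (phi & Hphi & _ & Hloc).
  apply (ccont_ext_loc _ (fun w => f z + phi w * (w - z))%C).
  - revert Hloc; apply filter_imp. intros w Hw. rewrite <- Hw. ring.
  - apply ccont_plus; [apply ccont_const|]. apply ccont_mult; [easy|].
    apply ccont_minus; [apply ccont_id | apply ccont_const].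
Qed.

Lemma cderiv_eq (f : C -> C) (z l l' : C) : cderiv f z l -> l = l' -> cderiv f z l'.
Proof. now intros ? <-. Qed.

Lemma cderiv_ext (f g : C -> C) (z l : C) : (forall w, f w = g w) -> cderiv f z l -> cderiv g z l.
Proof.
  intros E (phi & H1 & H2 & H3). exists phi. repeat split; try apply H1; try easy.
  revert H3; apply filter_imp. intros w. now rewrite !E.
Qed.

Lemma cderiv_const (c z : C) : cderiv (fun _ => c) z 0.
Proof.
  exists (fun _ => 0%C). repeat split; try apply continuous_const.
  apply filter_forall; intros; ring.
Qed.

Lemma cderiv_id (z : C) : cderiv (fun w => w) z 1.
Proof.
  exists (fun _ => 1%C). repeat split; try apply continuous_const.
  apply filter_forall; intros; ring.
Qed.

Lemma cderiv_plus (f g : C -> C) (z lf lg : C) : cderiv f z lf -> cderiv g z lg ->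
  cderiv (fun w => f w + g w)%C z (lf + lg).
Proof.
  intros (p & p1 & <- & p3) (q & q1 & <- & q3). exists (fun w => p w + q w)%C.
  split; [now apply ccont_plus|]. split; [easy|].
  generalize (filter_and _ _ p3 q3). apply filter_imp. intros w [e1 e2].
  replace (f w + g w - (f z + g z))%C with ((f w - f z) + (g w - g z))%C by ring.
  rewrite e1, e2. ring.
Qed.

Lemma cderiv_mult (f g : C -> C) (z lf lg : C) : cderiv f z lf -> cderiv g z lg ->
  cderiv (fun w => f w * g w)%C z (lf * g z + f z * lg).
Proof.
  intros Hf Hg. generalize (cderiv_ccont _ _ _ Hg); intros cg.
  destruct Hf as (p & p1 & <- & p3), Hg as (q & q1 & <- & q3).
  exists (fun w => p w * g w + f z * q w)%C.
  split; [apply ccont_plus; apply ccont_mult; try easy; apply ccont_const|]. split; [easy|].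
  generalize (filter_and _ _ p3 q3). apply filter_imp. intros w [e1 e2].
  replace (f w * g w - f z * g z)%C with ((f w - f z) * g w + f z * (g w - g z))%C by ring.
  rewrite e1, e2. ring.
Qed.

Lemma cderiv_comp (f g : C -> C) (z lf lg : C) : cderiv f (g z) lf -> cderiv g z lg ->
  cderiv (fun w => f (g w)) z (lf * lg).
Proof.
  intros Hf Hg. generalize (cderiv_ccont _ _ _ Hg); intros cg.
  destruct Hf as (p & p1 & <- & p3), Hg as (q & q1 & <- & q3).
  exists (fun w => p (g w) * q w)%C.
  split; [apply ccont_mult; [now apply ccont_comp | easy]|]. split; [easy|].
  assert (p4 := ccont_continuous _ _ cg _ p3). unfold filtermap in p4.
  generalize (filter_and _ _ p4 q3). apply filter_imp. intros w [e1 e2].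
  rewrite e1, e2. ring.
Qed.

Lemma locally_C_neq (z : C_UniformSpace) (c : C) : z <> c -> locally z (fun w => w <> c).
Proof.
  intros H. apply locally_C_Cmod. exists (Cmod (c - z)%C). split.
  - apply Cmod_gt_0. intros E. apply H.
    apply C_ext; [apply (f_equal fst) in E | apply (f_equal snd) in E]; simpl in E; lra.
  - intros w Hw ->. lra.
Qed.

Lemma cderiv_inv (z : C) : z <> 0 -> cderiv Cinv z (- / (z * z)).
Proof.
  intros H. exists (fun w => - / (w * z))%C. split.
  - apply ccont_opp, ccont_inv; [|now apply Cmult_neq_0].
    apply ccont_mult; [apply ccont_id | apply ccont_const].
  - split; [easy|]. generalize (locally_C_neq z 0 H). apply filter_imp. intros w Hw.
    field. now split.
Qed.

(** * The complex exponential and square root *)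

Lemma Cexp_plus (z w : C) : Cexp (z + w) = (Cexp z * Cexp w)%C.
Proof.
  apply C_ext; simpl; rewrite exp_plus, ?cos_plus, ?sin_plus; ring.
Qed.

Lemma Cmod_Cexp (z : C) : Cmod (Cexp z) = exp (fst z).
Proof.
  unfold Cmod, Cexp; simpl.
  replace (exp (fst z) * cos (snd z) * (exp (fst z) * cos (snd z) * 1) +
    exp (fst z) * sin (snd z) * (exp (fst z) * sin (snd z) * 1)) with
    (Rsqr (exp (fst z)) * (Rsqr (sin (snd z)) + Rsqr (cos (snd z)))) by (unfold Rsqr; ring).
  rewrite sin2_cos2, Rmult_1_r. apply sqrt_Rsqr. left; apply exp_pos.
Qed.

Lemma Cexp_0 : Cexp 0 = 1%C.
Proof. apply C_ext; simpl; rewrite exp_0, ?cos_0, ?sin_0; ring. Qed.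

(** Only the quadratic order matters, for the derivative at 0. The imaginary part is split as
    [(exp x - 1) sin y + (sin y - y)]. *)
Lemma Cexp_taylor (h : C) : Cmod h <= 1 / 2 -> Cmod (Cexp h - 1 - h)%C <= 4 * Cmod h ^ 2.
Proof.
  destruct h as [x y]. intros Hh. rewrite Cmod_sq.
  generalize (fst_le_Cmod (x, y)) (snd_le_Cmod (x, y)); simpl; intros Hx Hy.
  eapply Rle_trans; [apply Cmod_le_sum|]. simpl.
  assert (e1 : 1 + x <= exp x) by apply exp_ineq1_le.
  assert (e2 : exp x <= 1 + x + 2 * x ^ 2).
  { assert (h1 : 1 - x <= exp (- x)) by (generalize (exp_ineq1_le (- x)); lra).
    assert (h2 : exp x * exp (- x) = 1) by (rewrite <- exp_plus, Rplus_opp_r; apply exp_0).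
    generalize (exp_pos x) (exp_pos (- x)); intros p1 p2.
    assert (1 <= (1 + x + 2 * x ^ 2) * exp (- x)).
    { apply Rle_trans with ((1 + x + 2 * x ^ 2) * (1 - x)); nra. }
    apply Rmult_le_reg_r with (exp (- x)); [easy|]. lra. }
  assert (c1 : 0 <= 1 - cos y <= y ^ 2 / 2).
  { split; [generalize (COS_bound y); lra | apply one_minus_cos_le]. }
  assert (s1 : Rabs (sin y - y) <= y ^ 2 /\ Rabs (sin y) <= Rabs y).
  { assert (hs : exists c, Rabs c <= Rabs y /\ sin y = y * cos c).
    { destruct (Rtotal_order y 0) as [hy|[->|hy]].
      - destruct (MVT_cor2 sin cos y 0 hy) as (c & Hc & hc); [intros; apply derivable_pt_lim_sin|].
        exists c. rewrite sin_0 in Hc. split; [rewrite !Rabs_left; lra | lra].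
      - exists 0. rewrite sin_0. split; lra.
      - destruct (MVT_cor2 sin cos 0 y hy) as (c & Hc & hc); [intros; apply derivable_pt_lim_sin|].
        exists c. rewrite sin_0 in Hc. split; [rewrite !Rabs_pos_eq; lra | lra]. }
    destruct hs as (c & hc & ->).
    assert (hcc : c ^ 2 <= y ^ 2) by (rewrite <- (pow2_abs c), <- (pow2_abs y); generalize (Rabs_pos c); nra).
    generalize (one_minus_cos_le c) (COS_bound c); intros b1 b2. split.
    - replace (y * cos c - y) with (- (y * (1 - cos c))) by ring. rewrite Rabs_Ropp, Rabs_mult.
      rewrite (Rabs_pos_eq (1 - cos c)) by lra.
      assert (Rabs y <= 1/2) by (apply Rabs_le; lra). generalize (Rabs_pos y). nra.
    - rewrite Rabs_mult. rewrite <- (Rmult_1_r (Rabs y)) at 2.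
      apply Rmult_le_compat_l; [apply Rabs_pos|]. apply Rabs_le; lra. }
  destruct s1 as [s1 s2].
  apply Rle_trans with ((2 * x ^ 2 + y ^ 2) + (2 * (Rabs x * Rabs y) + y ^ 2)).
  - apply Rplus_le_compat.
    + apply Rabs_le. assert (0 <= exp x <= 2) by (generalize (exp_pos x); nra). split; nra.
    + replace (exp x * sin y + - 0 + - y) with ((exp x - 1) * sin y + (sin y - y)) by ring.
      eapply Rle_trans; [apply Rabs_triang|]. apply Rplus_le_compat; [|easy].
      rewrite Rabs_mult. rewrite <- Rmult_assoc.
      apply Rmult_le_compat; try apply Rabs_pos; [|easy].
      destruct (Rle_dec 0 x).
      * rewrite (Rabs_pos_eq x) by easy. apply Rabs_le; nra.
      * rewrite (Rabs_left x) by lra. apply Rabs_le; nra.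
  - assert (2 * (Rabs x * Rabs y) <= x ^ 2 + y ^ 2); [|nra].
    rewrite <- (pow2_abs x), <- (pow2_abs y). generalize (pow2_ge_0 (Rabs x - Rabs y)); nra.
Qed.

Lemma cderiv_Cexp (z : C) : cderiv Cexp z (Cexp z).
Proof.
  (* The difference quotient of [Cexp] at 0, completed by its limit 1; [Cexp_plus] carries it to
     every point. *)
  set (psi := fun h : C => if Req_EM_T (Cmod h) 0 then RtoC 1 else ((Cexp h - 1) / h)%C).
  assert (E : forall h, (Cexp h - 1 = psi h * h)%C).
  { intros h. unfold psi. destruct (Req_EM_T (Cmod h) 0) as [e|e].
    - apply Cmod_eq_0 in e. subst. rewrite Cexp_0. ring.
    - field. intros ->. apply e, Cmod_0. }
  assert (E0 : psi 0%C = 1%C).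
  { unfold psi. destruct (Req_EM_T (Cmod 0) 0) as [e|e]; [easy|]. now rewrite Cmod_0 in e. }
  assert (Hc : ccont psi (RtoC 0 : C_UniformSpace)).
  { apply ccont_eps. intros eps Heps. exists (Rmin (1 / 2) (eps / 8)).
    split; [apply Rmin_pos; lra|]. intros h Hh. rewrite E0.
    replace (h - 0)%C with h in Hh by ring.
    generalize (Rmin_l (1/2) (eps/8)) (Rmin_r (1/2) (eps/8)); intros m1 m2.
    destruct (Req_EM_T (Cmod h) 0) as [e|e].
    - apply Cmod_eq_0 in e. subst. rewrite E0. replace (1 - 1)%C with (RtoC 0) by ring. rewrite Cmod_0; lra.
    - assert (p : 0 < Cmod h) by (generalize (Cmod_ge_0 h); lra).
      generalize (Cexp_taylor h); intros ht.
      assert (Em : (Cexp h - 1 - h = (psi h - 1) * h)%C) by (rewrite E; ring).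
      rewrite Em, Cmod_mult in ht.
      assert (ht' : Cmod (psi h - 1) * Cmod h <= 4 * Cmod h * Cmod h) by (specialize (ht ltac:(lra)); nra).
      apply Rmult_le_reg_r in ht'; [|easy]. lra. }
  exists (fun w => Cexp z * psi (w - z))%C. split.
  - apply ccont_mult; [apply ccont_const|]. apply (ccont_comp psi (fun w => w - z)%C).
    + now replace (z - z)%C with (RtoC 0) by ring.
    + apply ccont_minus; [apply ccont_id | apply ccont_const].
  - split; [replace (z - z)%C with (RtoC 0) by ring; rewrite E0; ring|].
    apply filter_forall. intros w. rewrite <- Cmult_assoc, <- E.
    replace w with (z + (w - z))%C at 1 by ring. rewrite Cexp_plus. ring.
Qed.

(* Junk on the negative real axis. *)
Definition csqrt (u : C) : C :=
  let p := sqrt ((Cmod u + fst u) / 2) in (p, snd u / (2 * p)).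

Lemma csqrt_fst_pos (u : C) : 0 < Cmod u + fst u -> 0 < fst (csqrt u).
Proof. intros H. simpl. apply sqrt_lt_R0; lra. Qed.

Lemma csqrt_sq (u : C) : 0 < Cmod u + fst u -> (csqrt u * csqrt u = u)%C.
Proof.
  intros H. generalize (csqrt_fst_pos u H). unfold csqrt; simpl.
  set (p := sqrt _). intros Hp.
  assert (Ep : p * p = (Cmod u + fst u) / 2) by (apply sqrt_sqrt; lra).
  assert (Em := Cmod_sq u).
  apply C_ext; simpl; [|field; lra].
  replace (p * p - snd u / (2 * p) * (snd u / (2 * p))) with (p * p - snd u ^ 2 / (4 * (p * p))) by (field; lra).
  rewrite Ep. replace (snd u ^ 2) with (Cmod u ^ 2 - fst u ^ 2) by lra. field. lra.
Qed.

Lemma csqrt_ccont (u : C) : 0 < Cmod u + fst u -> ccont csqrt (u : C_UniformSpace).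
Proof.
  intros H. assert (Hp := csqrt_fst_pos u H).
  destruct (ccont_id u) as [c1 c2].
  assert (h : continuous (fun w : C_UniformSpace => sqrt ((Cmod w + fst w) / 2)) u).
  { apply continuous_sqrt_comp, continuous_Rdiv; [|apply continuous_const | lra].
    apply (continuous_plus (V := R_NormedModule)); [|easy]. apply (ccont_Cmod (fun w => w)), ccont_id. }
  split; [easy|]. simpl. apply continuous_Rdiv; [easy| |simpl in Hp; lra].
  apply (continuous_mult (K := R_AbsRing)); [apply continuous_const | easy].
Qed.

Lemma cderiv_csqrt (u : C) : 0 < Cmod u + fst u -> cderiv csqrt u (/ (csqrt u + csqrt u)).
Proof.
  intros H.
  assert (N : forall w, 0 < Cmod w + fst w -> (csqrt w + csqrt u)%C <> 0).
  { intros w Hw E. apply (f_equal fst) in E. generalize (csqrt_fst_pos u H) (csqrt_fst_pos w Hw).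
    simpl in *. lra. }
  exists (fun w => / (csqrt w + csqrt u))%C. split.
  - apply ccont_inv; [|now apply N]. apply ccont_plus; [now apply csqrt_ccont | apply ccont_const].
  - split; [easy|].
    assert (L : locally (u : C_UniformSpace) (fun w => 0 < Cmod w + fst w)).
    { assert (c : continuous (fun w : C_UniformSpace => Cmod w + fst w) u).
      { apply (continuous_plus (V := R_NormedModule)); [apply (ccont_Cmod (fun w => w)), ccont_id | apply ccont_id]. }
      apply (c (fun t => 0 < t)). now apply (open_gt 0). }
    revert L. apply filter_imp. intros w Hw.
    replace (w - u)%C with (csqrt w * csqrt w - csqrt u * csqrt u)%C by now rewrite !csqrt_sq.
    field. now apply N.
Qed.

(** In this form the chain rule for a complex function along a real curve is a product of continuous
    quotients. *)
Lemma is_derive_caratheodory (f : R -> R) (x l : R) : is_derive f x l <->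
  exists psi : R -> R, continuous psi x /\ psi x = l /\ locally x (fun t => f t - f x = psi t * (t - x)).
Proof.
  split.
  - intros H. apply is_derive_Reals in H.
    exists (fun t => if Req_EM_T t x then l else (f t - f x) / (t - x)).
    split; [|split].
    + apply filterlim_locally. intros [eps Heps]. destruct (H eps Heps) as [d Hd].
      exists d. intros t Ht. destruct (Req_EM_T x x); [|easy].
      destruct (Req_EM_T t x) as [->|Ht']; [apply ball_center|].
      specialize (Hd (t - x)). replace (x + (t - x)) with t in Hd by (unfold Rminus; now rewrite (Rplus_comm t), <- Rplus_assoc, Rplus_opp_r, Rplus_0_l).
      apply Hd; [lra | exact Ht].
    + now destruct (Req_EM_T x x).
    + apply filter_forall. intros t. destruct (Req_EM_T t x) as [->|Ht]; [ring | field; lra].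
  - intros (psi & Hc & <- & [d1 H1]). apply is_derive_Reals. intros eps Heps.
    destruct (proj1 (filterlim_locally _ _) Hc (mkposreal _ Heps)) as [d2 H2].
    assert (Hd : 0 < Rmin d1 d2) by (apply Rmin_pos; apply cond_pos).
    exists (mkposreal _ Hd). intros h Hh Hhd. simpl in Hhd.
    assert (b : forall d : posreal, Rmin d1 d2 <= d -> ball x d (x + h)).
    { intros d hd. unfold ball; simpl. unfold AbsRing_ball, abs, minus, plus, opp; simpl.
      replace (x + h + - x) with h by ring. lra. }
    rewrite (H1 (x + h)) by apply b, Rmin_l.
    replace (psi (x + h) * (x + h - x) / h) with (psi (x + h)) by (field; easy).
    apply (H2 (x + h)), b, Rmin_r.
Qed.

Lemma cderiv_along_curve (f : C -> C) (g1 g2 : R -> R) (t d1 d2 : R) (l : C) :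
  cderiv f (g1 t, g2 t) l -> is_derive g1 t d1 -> is_derive g2 t d2 ->
  is_derive (fun s => fst (f (g1 s, g2 s))) t (fst (l * (d1, d2))%C) /\
  is_derive (fun s => snd (f (g1 s, g2 s))) t (snd (l * (d1, d2))%C).
Proof.
  intros (phi & Hphi & <- & Hloc) H1 H2.
  assert (c1 : continuous g1 t) by (apply (ex_derive_continuous (V := R_NormedModule)); eexists; apply H1).
  assert (c2 : continuous g2 t) by (apply (ex_derive_continuous (V := R_NormedModule)); eexists; apply H2).
  assert (cg : ccont (fun s => (g1 s, g2 s)) t) by now split.
  assert (Hphi' := ccont_comp phi (fun s => (g1 s, g2 s)) t Hphi cg).
  assert (Hloc' := ccont_continuous _ _ cg _ Hloc). unfold filtermap in Hloc'.
  apply is_derive_caratheodory in H1, H2.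
  destruct H1 as (p1 & k1 & <- & L1), H2 as (p2 & k2 & <- & L2).
  assert (Hm := ccont_mult _ (fun s => (p1 s, p2 s)) t Hphi' (conj k1 k2)).
  split; apply is_derive_caratheodory.
  - exists (fun s => fst (phi (g1 s, g2 s) * (p1 s, p2 s))%C). split; [apply Hm|]. split; [easy|].
    generalize (filter_and _ _ Hloc' (filter_and _ _ L1 L2)). apply filter_imp.
    intros s (e & e1 & e2). apply (f_equal fst) in e. simpl in *.
    unfold Rminus in *. rewrite e, e1, e2. ring.
  - exists (fun s => snd (phi (g1 s, g2 s) * (p1 s, p2 s))%C). split; [apply Hm|]. split; [easy|].
    generalize (filter_and _ _ Hloc' (filter_and _ _ L1 L2)). apply filter_imp.
    intros s (e & e1 & e2). apply (f_equal snd) in e. simpl in *.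
    unfold Rminus in *. rewrite e, e1, e2. ring.
Qed.

(** * Schwarz lemma for the half-plane *)

Definition circ (t phi : R) : C := (t * cos phi, t * sin phi).

Lemma Cmod_circ (t phi : R) : Cmod (circ t phi) = Rabs t.
Proof.
  unfold circ, Cmod; simpl.
  replace (t * cos phi * (t * cos phi * 1) + t * sin phi * (t * sin phi * 1)) with
    (Rsqr t * (Rsqr (sin phi) + Rsqr (cos phi))) by (unfold Rsqr; ring).
  rewrite sin2_cos2, Rmult_1_r. apply sqrt_Rsqr_abs.
Qed.

Lemma circ_ccont_angle (t phi : R) : ccont (circ t) phi.
Proof.
  split; simpl; apply (continuous_mult (K := R_AbsRing)); try apply continuous_const;
  [apply continuous_cos | apply continuous_sin].
Qed.

Lemma circ_ccont_2d (t phi : R) :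
  ccont (fun z : R * R => circ (fst z) (snd z)) ((t, phi) : prod_UniformSpace R_UniformSpace R_UniformSpace).
Proof.
  assert (c1 := continuous_fst (U := R_UniformSpace) (V := R_UniformSpace) t phi).
  assert (c2 := continuous_snd (U := R_UniformSpace) (V := R_UniformSpace) t phi).
  split; simpl; apply (continuous_mult (K := R_AbsRing)); try apply c1;
  [apply (continuous_comp snd cos) | apply (continuous_comp snd sin)]; try apply c2;
  [apply continuous_cos | apply continuous_sin].
Qed.

Section CircleMean.
Context (G dG : C -> C) (r : R).
Hypotheses (HG : forall z, 0 < Cmod z < r -> cderiv G z (dG z))
  (HdG : forall z, 0 < Cmod z < r -> ccont dG (z : C_UniformSpace)).

Let mean (t : R) : R := RInt (fun phi => fst (G (circ t phi))) 0 (2 * PI).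

Local Lemma circ_in (t phi : R) : 0 < t < r -> 0 < Cmod (circ t phi) < r.
Proof. rewrite Cmod_circ. intros H. rewrite Rabs_pos_eq; lra. Qed.

Local Lemma radial_derive (t phi : R) : 0 < t < r ->
  is_derive (fun u => fst (G (circ u phi))) t (fst (dG (circ t phi) * circ 1 phi)%C).
Proof.
  intros Ht. unfold circ at 3. rewrite !Rmult_1_l.
  apply (cderiv_along_curve G (fun u => u * cos phi) (fun u => u * sin phi)).
  - now apply HG, circ_in.
  - auto_derive; [easy | ring].
  - auto_derive; [easy | ring].
Qed.

(** The Cauchy-Riemann equations in polar form: the derivative is the one in [radial_derive]. *)
Local Lemma angular_derive (t phi : R) : 0 < t < r ->
  is_derive (fun s => snd (G (circ t s)) / t) phi (fst (dG (circ t phi) * circ 1 phi)%C).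
Proof.
  intros Ht.
  replace (fst (dG (circ t phi) * circ 1 phi)%C) with
    (/ t * snd (dG (circ t phi) * ((- (t * sin phi))%R, (t * cos phi)%R))%C) by (simpl; field; lra).
  apply (is_derive_ext (fun s => / t * snd (G (circ t s)))); [intros; simpl; field; lra|].
  apply is_derive_scal.
  apply (cderiv_along_curve G (fun u => t * cos u) (fun u => t * sin u)).
  - now apply HG, circ_in.
  - auto_derive; [easy | ring].
  - auto_derive; [easy | ring].
Qed.

Local Lemma integrand_continuous (t phi : R) : 0 < t < r ->
  continuous (fun s => fst (G (circ t s))) phi.
Proof.
  intros Ht. assert (h : ccont (fun s => G (circ t s)) phi); [|exact (proj1 h)].
  apply ccont_comp; [|apply circ_ccont_angle].
  eapply cderiv_ccont. now apply HG, circ_in.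
Qed.

Local Lemma locally_radius (t : R) : 0 < t < r -> locally t (fun u => 0 < u < r).
Proof.
  intros [h1 h2]. apply (filter_and (fun u => 0 < u) (fun u => u < r));
  [now apply (open_gt 0) | now apply (open_lt r)].
Qed.

(** Under the integral the radial derivative is also an angular derivative, and its integral over a
    full period vanishes. *)
Local Lemma mean_derive (t : R) : 0 < t < r -> is_derive mean t 0.
Proof.
  intros Ht.
  assert (E : RInt (fun phi => Derive (fun u => fst (G (circ u phi))) t) 0 (2 * PI) = 0).
  { rewrite (RInt_ext _ (fun phi => fst (dG (circ t phi) * circ 1 phi)%C)).
    2: { intros phi _. apply is_derive_unique, radial_derive, Ht. }
    apply is_RInt_unique.
    replace 0 with (minus (snd (G (circ t (2 * PI))) / t) (snd (G (circ t 0)) / t)) at 2.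
    - apply (is_RInt_derive (V := R_CompleteNormedModule) (fun s => snd (G (circ t s)) / t)).
      + intros phi _. now apply angular_derive.
      + intros phi _.
        assert (h : ccont (fun s => dG (circ t s) * circ 1 s)%C phi); [|exact (proj1 h)].
        apply ccont_mult; [|apply circ_ccont_angle].
        apply ccont_comp; [|apply circ_ccont_angle]. now apply HdG, circ_in.
    - unfold circ. rewrite cos_2PI, sin_2PI, cos_0, sin_0. apply (minus_eq_zero (G := R_AbelianGroup)). }
  rewrite <- E. apply (is_derive_RInt_param (fun u phi => fst (G (circ u phi)))).
  - generalize (locally_radius t Ht). apply filter_imp. intros u Hu phi _.
    eexists. now apply radial_derive.
  - intros phi _.
    apply continuity_2d_pt_ext_loc with (fun u v => fst (dG (circ u v) * circ 1 v)%C).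
    + destruct (locally_radius t Ht) as [d Hd]. exists d. intros u v Hu _.
      symmetry. apply is_derive_unique, radial_derive. apply Hd. exact Hu.
    + apply continuity_2d_pt_filterlim.
      assert (c := circ_ccont_2d t phi).
      assert (h : ccont (fun z => dG (circ (fst z) (snd z)) * circ 1 (snd z))%C
        ((t, phi) : prod_UniformSpace R_UniformSpace R_UniformSpace)); [|exact (proj1 h)].
      apply ccont_mult.
      * apply (ccont_comp dG (fun z : prod_UniformSpace R_UniformSpace R_UniformSpace => circ (fst z) (snd z))); [|easy].
        now apply HdG, circ_in.
      * assert (c2 := continuous_snd (U := R_UniformSpace) (V := R_UniformSpace) t phi).
        destruct (circ_ccont_angle 1 phi) as [d1 d2].
        split; [apply (continuous_comp snd (fun v => fst (circ 1 v))) | apply (continuous_comp snd (fun v => snd (circ 1 v)))]; easy.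
  - generalize (locally_radius t Ht). apply filter_imp. intros u Hu.
    apply (ex_RInt_continuous (V := R_CompleteNormedModule)). intros phi _. now apply integrand_continuous.
Qed.

(** The circle means do not depend on the radius, and on tiny circles a negative value at 0 would
    make them negative. Asking only for continuity at 0 spares any study of differentiability at the
    removable singularity met in [schwarz_directional]. *)
Lemma min_principle (t : R) : 0 < t < r -> ccont G (RtoC 0 : C_UniformSpace) ->
  (forall z, Cmod z = t -> 0 <= fst (G z)) -> 0 <= fst (G 0).
Proof.
  intros Ht H0 Hpos. apply Rnot_lt_le. intros Hneg.
  destruct (proj1 (ccont_eps G (RtoC 0)) H0 (- fst (G 0))) as (d & Hd & Hw); [lra|].
  set (s := Rmin (t / 2) (d / 2)).
  assert (Hs : 0 < s) by (apply Rmin_pos; lra).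
  assert (Hst : s <= t / 2) by apply Rmin_l.
  assert (Hsd : s <= d / 2) by apply Rmin_r.
  assert (Em : mean s = mean t).
  { apply (eq_is_derive mean); [|lra]. intros u Hu. apply mean_derive. lra. }
  assert (Hmt : 0 <= mean t).
  { apply RInt_ge_0; [generalize PI_RGT_0; lra| |].
    - apply (ex_RInt_continuous (V := R_CompleteNormedModule)). intros phi _. now apply integrand_continuous.
    - intros phi _. apply Hpos. rewrite Cmod_circ. apply Rabs_pos_eq; lra. }
  assert (Hms : mean s < RInt (fun _ => 0) 0 (2 * PI)).
  { apply RInt_lt; [generalize PI_RGT_0; lra| | |].
    - intros; apply continuous_const.
    - intros phi _. apply integrand_continuous; lra.
    - intros phi _. specialize (Hw (circ s phi)).
      replace (circ s phi - 0)%C with (circ s phi) in Hw by ring.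
      rewrite Cmod_circ, Rabs_pos_eq in Hw by lra.
      specialize (Hw ltac:(lra)). generalize (fst_le_Cmod (G (circ s phi) - G 0)%C). simpl. simpl in Hw. lra. }
  rewrite RInt_const in Hms. unfold scal in Hms; simpl in Hms. unfold mult in Hms; simpl in Hms. lra.
Qed.
End CircleMean.

Section Schwarz.
Context (H dH : C -> C) (r : R).
Hypotheses (HH : forall z, Cmod z < r -> cderiv H z (dH z))
  (HdH : forall z, Cmod z < r -> ccont dH (z : C_UniformSpace))
  (Hpos : forall z, Cmod z < r -> 0 < fst (H z)).

(* On [|z| = t] the real part of
   [t c (H z - H 0) / z + z (H z + conj (H 0)) / (c t) + 2 H z]
   is [2 Re (H z) (1 + Re (c t / z)) >= 0], and at [0] it is [Re (t c H' 0 + 2 H 0)]. *)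
Lemma schwarz_directional (c : C) (t : R) : Cmod c = 1 -> 0 < t < r ->
  0 <= fst (t * c * dH 0 + 2 * H 0)%C.
Proof.
  intros Hc Ht.
  assert (H0r : Cmod 0 < r) by (rewrite Cmod_0; lra).
  assert (Ht0 : RtoC t <> 0) by (intros E; apply (f_equal fst) in E; simpl in E; lra).
  destruct (HH 0 H0r) as (q & q1 & q2 & q3).
  set (K := (Cconj c / t)%C).
  set (G := fun z : C => (t * c * (if Req_EM_T (Cmod z) 0 then dH 0 else (H z - H 0) / z)
      + z * K * (H z + Cconj (H 0)) + 2 * H z)%C).
  set (dG := fun z : C => (t * c * ((dH z + 0) * / z + (H z + - H 0) * (- / (z * z) * 1))
      + ((1 * K + z * 0) * (H z + Cconj (H 0)) + z * K * (dH z + 0)) + (0 * H z + 2 * dH z))%C).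
  assert (E0 : G 0 = (t * c * dH 0 + 2 * H 0)%C).
  { unfold G. destruct (Req_EM_T (Cmod 0) 0) as [e|e]; [ring | now rewrite Cmod_0 in e]. }
  assert (Hn : forall z, 0 < Cmod z -> z <> 0).
  { intros z Hz ->. rewrite Cmod_0 in Hz. lra. }
  rewrite <- E0. apply (min_principle G dG r) with t; [| |easy| |].
  - intros z Hz.
    assert (D : cderiv (fun z => (t * c * ((H z + - H 0) * / z)) + z * K * (H z + Cconj (H 0)) + 2 * H z)%C z (dG z)).
    { assert (dz := HH z (proj2 Hz)).
      unfold dG. apply cderiv_plus; [apply cderiv_plus|].
      - eapply cderiv_eq; [apply cderiv_mult; [apply cderiv_const|]|].
        + apply cderiv_mult; [apply cderiv_plus; [apply dz | apply cderiv_const]|].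
          apply (cderiv_comp Cinv (fun w => w)); [apply cderiv_inv, Hn, Hz | apply cderiv_id].
        + cbv beta. ring.
      - apply (cderiv_mult (fun z => z * K)%C (fun z => H z + Cconj (H 0))%C).
        + apply (cderiv_mult (fun z => z) (fun _ => K)); [apply cderiv_id | apply cderiv_const].
        + apply cderiv_plus; [apply dz | apply cderiv_const].
      - apply (cderiv_mult (fun _ => RtoC 2) H); [apply cderiv_const | apply dz]. }
    destruct D as (p & p1 & p2 & p3). exists p. split; [easy|]. split; [easy|].
    generalize (filter_and _ _ p3 (locally_C_neq z 0 (Hn z (proj1 Hz)))). apply filter_imp.
    intros w [e ne]. unfold G.
    destruct (Req_EM_T (Cmod w) 0) as [e'|_]; [now apply Cmod_eq_0 in e'|].
    destruct (Req_EM_T (Cmod z) 0) as [e'|_]; [lra|].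
    exact e.
  - intros z Hz. assert (ch := cderiv_ccont _ _ _ (HH z (proj2 Hz))).
    assert (cd := HdH z (proj2 Hz)). assert (ci := ccont_id z).
    assert (nz := Hn z (proj1 Hz)).
    unfold dG. ccont_auto; [easy | now apply Cmult_neq_0].
  (* The Caratheodory quotient [q] of [H] at 0 fills the removable singularity continuously. *)
  - apply (ccont_ext_loc _ (fun z : C_UniformSpace => t * c * q z + z * K * (H z + Cconj (H 0)) + 2 * H z)%C).
    + revert q3. apply filter_imp. intros w e. unfold G. do 2 f_equal. f_equal.
      destruct (Req_EM_T (Cmod w) 0) as [e'|e'].
      * apply Cmod_eq_0 in e'. now subst.
      * rewrite e. field. intros ->. now rewrite Cmod_0 in e'.
    + assert (ch := cderiv_ccont _ _ _ (HH 0 H0r)). assert (ci := ccont_id (RtoC 0)).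
      ccont_auto.
  - intros z Hz. unfold G. destruct (Req_EM_T (Cmod z) 0) as [e|_]; [lra|].
    assert (nz : z <> 0) by (apply Hn; lra).
    set (d := (z * K)%C).
    (* On [|z| = t] the unimodular number [t c / z] is the conjugate of [d = z K]. *)
    assert (Ed : (t * c * ((H z - H 0) / z) = Cconj d * (H z - H 0))%C).
    { unfold d, K.
      replace (t * c * ((H z - H 0) / z))%C with (t * c / z * (H z - H 0))%C by (field; easy).
      f_equal. unfold Cdiv. rewrite !Cmult_conj, Cconj_conj.
      assert (Ez : (Cconj z * z = t * t)%C).
      { apply C_ext; simpl; generalize (Cmod_sq z); rewrite Hz; nra. }
      assert (Ei : Cconj (/ t) = (/ t)%C).
      { apply C_ext; simpl; field; lra. }
      rewrite Ei. replace (t * c * / z)%C with (t * t * c * / z * / t)%C by (field; easy).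
      rewrite <- Ez. field. easy. }
    assert (Hd : -1 <= fst d).
    { assert (Em : Cmod d = 1).
      { unfold d, K. rewrite Cmod_mult, Cmod_div, Cmod_conj, Hc, Hz, Cmod_R, Rabs_pos_eq by (easy || lra).
        field. lra. }
      generalize (fst_le_Cmod d). lra. }
    rewrite Ed.
    assert (Hz' : 0 < fst (H z)) by (apply Hpos; lra).
    (* The two terms with [H 0] have opposite real parts, and [d] plus its conjugate is real. *)
    replace (fst (Cconj d * (H z - H 0) + d * (H z + Cconj (H 0)) + 2 * H z)%C) with
      (2 * fst (H z) * (1 + fst d)) by (simpl; ring).
    nra.
Qed.

(** The directions 1, -1, [Ci] and [- Ci] at radius [r / 2] bound the two coordinates of [dH 0]. The
    sharp constant is 2; any constant serves. *)
Lemma schwarz_half_plane : 0 < r -> Cmod (dH 0) * r <= 8 * fst (H 0).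
Proof.
  intros Hr.
  assert (m1 : Cmod (- (1))%C = 1) by (rewrite Cmod_opp; apply Cmod_1).
  assert (m2 : Cmod (- Ci)%C = 1) by (rewrite Cmod_opp; apply Cmod_Ci).
  assert (t2 : 0 < r / 2 < r) by lra.
  generalize (schwarz_directional 1 _ Cmod_1 t2) (schwarz_directional _ _ m1 t2)
    (schwarz_directional _ _ Cmod_Ci t2) (schwarz_directional _ _ m2 t2).
  simpl. intros a1 a2 a3 a4.
  assert (b1 : Rabs (fst (dH 0)) * r <= 4 * fst (H 0)).
  { rewrite <- (Rabs_pos_eq r) at 1 by lra. rewrite <- Rabs_mult. apply Rabs_le; lra. }
  assert (b2 : Rabs (snd (dH 0)) * r <= 4 * fst (H 0)).
  { rewrite <- (Rabs_pos_eq r) at 1 by lra. rewrite <- Rabs_mult. apply Rabs_le; lra. }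
  generalize (Cmod_le_sum (dH 0)). nra.
Qed.
End Schwarz.

(** * Iterates *)

Definition dzeta (lam : R) (z : C) : C :=
  (lam * Cexp (- z) * (1 - z - z * z) / ((z + 1) * (z + 1)))%C.

Lemma neq_m1 (z : C) : z <> RtoC (-1) -> (z + 1)%C <> 0.
Proof.
  intros H E. apply H. apply C_ext; [apply (f_equal fst) in E | apply (f_equal snd) in E];
  simpl in *; lra.
Qed.

Lemma cderiv_zeta (lam : R) (z : C) : z <> RtoC (-1) -> cderiv (zeta lam) z (dzeta lam z).
Proof.
  intros H%neq_m1. unfold zeta, Cdiv.
  assert (d1 : cderiv (fun w => / (w + 1))%C z (- / ((z + 1) * (z + 1)) * (1 + 0))).
  { apply (cderiv_comp Cinv (fun w => w + 1)%C); [now apply cderiv_inv|].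
    apply cderiv_plus; [apply cderiv_id | apply cderiv_const]. }
  assert (d2 := cderiv_mult _ _ _ _ _ (cderiv_id z) d1).
  assert (d3 := cderiv_mult _ _ _ _ _ (cderiv_const (RtoC lam) z) d2).
  assert (d4 : cderiv (fun w => Cexp (- w)) z (Cexp (- z) * (- (1) * 1 + 0))).
  { apply (cderiv_comp Cexp Copp); [apply cderiv_Cexp|].
    apply (cderiv_ext (fun w => - (1) * w)%C); [intros; ring|].
    eapply cderiv_eq; [apply (cderiv_mult (fun _ => - (1))%C (fun w => w)); [apply cderiv_const | apply cderiv_id]|].
    ring. }
  eapply cderiv_eq; [apply (cderiv_mult _ _ _ _ _ d3 d4)|].
  unfold dzeta. cbv beta. field. easy.
Qed.

Lemma dzeta_ccont (lam : R) (z : C) : z <> RtoC (-1) -> ccont (dzeta lam) (z : C_UniformSpace).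
Proof.
  intros H%neq_m1. unfold dzeta.
  assert (c1 : ccont (fun w : C_UniformSpace => w) z) by apply ccont_id.
  assert (c2 : ccont (fun w : C_UniformSpace => Cexp (- w)) z).
  { apply ccont_comp; [eapply cderiv_ccont, cderiv_Cexp | now apply ccont_opp]. }
  ccont_auto. now apply Cmult_neq_0.
Qed.

Lemma Cmod_zeta (lam : R) (z : C) : 0 <= lam -> z <> RtoC (-1) ->
  Cmod (zeta lam z) = lam * (Cmod z / Cmod (z + 1)) * exp (- fst z).
Proof.
  intros Hl H%neq_m1. unfold zeta.
  rewrite !Cmod_mult, Cmod_div, Cmod_R, Cmod_Cexp, Rabs_pos_eq by easy. easy.
Qed.

Lemma zeta_neq_0 (lam : R) (z : C) : 0 < lam -> z <> RtoC (-1) -> z <> 0 -> zeta lam z <> 0.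
Proof.
  intros Hl H Hz E. apply (f_equal Cmod) in E. rewrite Cmod_zeta, Cmod_0 in E by (easy || lra).
  apply neq_m1, Cmod_gt_0 in H. apply Cmod_gt_0 in Hz.
  assert (0 < lam * (Cmod z / Cmod (z + 1)) * exp (- fst z)); [|lra].
  apply Rmult_lt_0_compat; [|apply exp_pos]. apply Rmult_lt_0_compat; [easy|].
  now apply Rdiv_lt_0_compat.
Qed.

(* [Cmod u * (Cmod u - fst u)] is, up to a factor, the inverse square of the
   hyperbolic density of the plane slit along the nonnegative real axis. *)
Lemma zeta_expands (lam : R) (z : C) (e r0 : R) : 0 < lam -> z <> RtoC (-1) ->
  fst z < Cmod z -> 0 <= e <= 1 -> 0 <= r0 <= 1 -> r0 <= Cmod z -> fst z <= (1 - e) * Cmod z ->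
  (1 + r0 ^ 4 * e ^ 2 / 32) * (Cmod (zeta lam z) * (Cmod (zeta lam z) - fst (zeta lam z))) <=
  Cmod (dzeta lam z) ^ 2 * (Cmod z * (Cmod z - fst z)).
Proof.
  intros Hl H HO He Hr0 Hrr Hxe. assert (Hn := neq_m1 z H).
  (* The absolute value of the imaginary part reduces to the upper half-plane treated by
     [expansion], by symmetry under conjugation. *)
  set (x := fst z) in *. set (y := Rabs (snd z)). set (r := Cmod z) in *. set (s := Cmod (z + 1)%C).
  assert (Hs : 0 < s) by now apply Cmod_gt_0.
  assert (Hr : 0 < r) by (generalize (fst_le_Cmod z); unfold r, x in *; lra).
  assert (Hy2 : y ^ 2 = snd z ^ 2) by apply pow2_abs.
  assert (Er : r ^ 2 = x ^ 2 + y ^ 2) by (rewrite Hy2; apply Cmod_sq).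
  assert (Es : s ^ 2 = (1 + x) ^ 2 + y ^ 2).
  { rewrite Hy2. unfold s. rewrite Cmod_sq. simpl. unfold x. ring. }
  assert (Hy : 0 <= y) by apply Rabs_pos.
  destruct (subtended_angle x y r s Hr Hs Er Es Hy) as (psi & Hpsi & Ec & Esn).
  set (W := r ^ 2 + (1 + 2 * y ^ 2 - 2 * x ^ 2 - 2 * x) / s ^ 2).
  assert (Hyx : 0 < y \/ x < 0).
  { destruct (Rlt_dec x 0); [now right | left]. destruct Hy as [Hy|Hy]; [easy|].
    rewrite <- Hy in Er. nra. }
  generalize (expansion x y r s psi W Hr Hs Hy Er Es Hpsi Ec Esn eq_refl e r0 Hyx He Hr0 Hrr Hxe).
  assert (Em : Cmod (zeta lam z) = lam * (r / s) * exp (- x)) by (apply Cmod_zeta; [lra | easy]).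
  assert (Ef : fst (zeta lam z) = Cmod (zeta lam z) * cos (psi - y)).
  { rewrite Em, cos_minus, Ec, Esn.
    assert (Ey : y * sin y = snd z * sin (snd z) /\ cos y = cos (snd z)).
    { unfold y. destruct (Rle_dec 0 (snd z)) as [h|h].
      - now rewrite Rabs_pos_eq.
      - rewrite Rabs_left by lra. rewrite sin_neg, cos_neg. split; ring. }
    destruct Ey as [Ey1 Ey2].
    replace (lam * (r / s) * exp (- x) * ((r ^ 2 + x) / (r * s) * cos y + y / (r * s) * sin y)) with
      (lam * exp (- x) * ((r ^ 2 + x) * cos y + y * sin y) / s ^ 2) by (field; lra).
    rewrite Ey1, Ey2. unfold r. rewrite Cmod_sq.
    unfold zeta, Cexp; simpl. rewrite cos_neg, sin_neg.
    fold x. replace ((x + 1) * ((x + 1) * 1) + (snd z + 0) * ((snd z + 0) * 1)) with (s ^ 2)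
      by (rewrite Es, Hy2; ring).
    field. lra. }
  assert (Ed : Cmod (dzeta lam z) ^ 2 = Cmod (zeta lam z) ^ 2 * W / r ^ 2).
  { rewrite Em. unfold dzeta. rewrite Cmod_div by now apply Cmult_neq_0.
    rewrite !Cmod_mult, Cmod_R, Cmod_Cexp, Rabs_pos_eq by lra. fold s.
    replace (fst (- z)%C) with (- x) by easy.
    assert (E1 : Cmod (1 - z - z * z) ^ 2 = r ^ 2 * s ^ 2 + (1 + 2 * y ^ 2 - 2 * x ^ 2 - 2 * x)).
    { rewrite Cmod_sq, Er, Es, Hy2. simpl. unfold x. ring. }
    replace ((lam * exp (- x) * Cmod (1 - z - z * z) / (s * s)) ^ 2) with
      (lam ^ 2 * exp (- x) ^ 2 * Cmod (1 - z - z * z) ^ 2 / s ^ 4) by (field; lra).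
    rewrite E1. unfold W. field. lra. }
  intros HM. rewrite Ef, Ed. set (m := Cmod (zeta lam z)) in *.
  replace (m ^ 2 * W / r ^ 2 * (r * (r - x))) with (m ^ 2 / r * (W * (r - x))) by (field; lra).
  replace ((1 + r0 ^ 4 * e ^ 2 / 32) * (m * (m - m * cos (psi - y)))) with
    (m ^ 2 / r * ((1 + r0 ^ 4 * e ^ 2 / 32) * (r * (1 - cos (psi - y))))) by (field; lra).
  apply Rmult_le_compat_l; [|exact HM]. apply Rdiv_le_0_compat; [nra | easy].
Qed.

Definition orbit (lam : R) (n : nat) (z : C) : C := Nat.iter n (zeta lam) z.

Fixpoint dorbit (lam : R) (n : nat) (z : C) : C :=
  match n with
  | O => 1%C
  | S n => (dzeta lam (orbit lam n z) * dorbit lam n z)%C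
  end.

(** [zeta] is total, with a junk value at -1; under this guard [orbit] agrees with [iterh]. The
    [n]-th point itself may be the pole. *)
Definition no_pole (lam : R) (n : nat) (z : C) : Prop :=
  forall k, (k < n)%nat -> orbit lam k z <> RtoC (-1).

Lemma orbit_add (lam : R) (n m : nat) (z : C) : orbit lam (n + m) z = orbit lam n (orbit lam m z).
Proof. apply Nat.iter_add. Qed.

Lemma no_pole_S (lam : R) (n : nat) (z : C) :
  no_pole lam (S n) z <-> no_pole lam n z /\ orbit lam n z <> RtoC (-1).
Proof.
  split.
  - intros H. split; [|apply H; lia]. intros k Hk. apply H; lia.
  - intros [H1 H2] k Hk. destruct (Nat.eq_dec k n) as [->|]; [easy|]. apply H1; lia.
Qed.

Lemma zetah_Some (lam : R) (z : C) : z <> RtoC (-1) -> zetah lam (Some z) = Some (zeta lam z).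
Proof.
  intros H. simpl. destruct (Req_EM_T (fst z) (-1)) as [e1|]; [|easy].
  destruct (Req_EM_T (snd z) 0) as [e2|]; [|easy]. exfalso. now apply H, C_ext.
Qed.

Lemma zetah_pole (lam : R) : zetah lam (Some (RtoC (-1))) = None.
Proof.
  simpl. destruct (Req_EM_T (-1) (-1)); [|easy]. now destruct (Req_EM_T 0 0).
Qed.

Lemma iterh_Some (lam : R) (n : nat) (z : C) : no_pole lam n z ->
  iterh lam n (Some z) = Some (orbit lam n z).
Proof.
  induction n as [|n IH]; [easy|]. intros [H1 H2]%no_pole_S.
  unfold iterh in *. simpl Nat.iter. rewrite IH by easy. now apply zetah_Some.
Qed.

Lemma iterh_no_pole (lam : R) (n : nat) (z : C) : iterh lam n (Some z) <> None -> no_pole lam n z.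
Proof.
  induction n as [|n IH]; [intros _ k Hk; lia|]. intros H.
  assert (H1 : no_pole lam n z).
  { apply IH. intros E. apply H. unfold iterh in *. simpl Nat.iter. now rewrite E. }
  apply no_pole_S. split; [easy|]. intros E. apply H.
  assert (E' := iterh_Some lam n z H1). unfold iterh in *. simpl Nat.iter.
  rewrite E', E. apply zetah_pole.
Qed.

Lemma no_pole_add (lam : R) (n m : nat) (z : C) :
  no_pole lam m z -> no_pole lam n (orbit lam m z) -> no_pole lam (n + m) z.
Proof.
  intros H1 H2 k Hk. destruct (Nat.lt_ge_cases k m) as [h|h]; [now apply H1|].
  replace k with ((k - m) + m)%nat by lia. rewrite orbit_add. apply H2; lia.
Qed.

Lemma orbit_cderiv (lam : R) (n : nat) (z : C) : no_pole lam n z ->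
  cderiv (orbit lam n) z (dorbit lam n z).
Proof.
  induction n as [|n IH]; [intros; apply cderiv_id|]. intros [H1 H2]%no_pole_S.
  apply (cderiv_comp (zeta lam) (orbit lam n)); [now apply cderiv_zeta | now apply IH].
Qed.

Lemma orbit_ccont (lam : R) (n : nat) (z : C) : no_pole lam n z ->
  ccont (orbit lam n) (z : C_UniformSpace).
Proof. intros H. eapply cderiv_ccont. now apply orbit_cderiv. Qed.

Lemma dorbit_ccont (lam : R) (n : nat) (z : C) : no_pole lam n z ->
  ccont (dorbit lam n) (z : C_UniformSpace).
Proof.
  induction n as [|n IH]; [intros; apply ccont_const|]. intros [H1 H2]%no_pole_S.
  apply (ccont_mult (fun w => dzeta lam (orbit lam n w)) (dorbit lam n)); [|now apply IH].
  apply ccont_comp; [now apply dzeta_ccont | now apply orbit_ccont].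
Qed.

Lemma no_pole_locally (lam : R) (n : nat) (z : C) : no_pole lam n z ->
  locally (z : C_UniformSpace) (no_pole lam n).
Proof.
  induction n as [|n IH].
  - intros _. apply filter_forall. intros w k Hk. lia.
  - intros [H1 H2]%no_pole_S.
    assert (c := ccont_continuous _ _ (orbit_ccont lam n z H1)).
    assert (L := c _ (locally_C_neq _ _ H2)). unfold filtermap in L.
    generalize (filter_and _ _ (IH H1) L). apply filter_imp. intros w [a b]. now apply no_pole_S.
Qed.

(** Schwarz's lemma is applied to [p = sqrt (- F)], with values in the right half-plane:
    [|F'| = 2 |p| |p'|], [|p|^2 = |F|] and [(Re p)^2 = (|F| - Re F) / 2]. Squaring
    [|F'| rho <= 16 |p| Re p] gives [128 = 16^2 / 2]. *)
Lemma schwarz_orbit (lam : R) (n : nat) (z0 : C) (rho : R) : 0 < rho ->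
  (forall v, Cmod (v - z0) < rho -> no_pole lam n v /\ fst (orbit lam n v) < Cmod (orbit lam n v)) ->
  Cmod (dorbit lam n z0) ^ 2 * rho ^ 2 <=
  128 * (Cmod (orbit lam n z0) * (Cmod (orbit lam n z0) - fst (orbit lam n z0))).
Proof.
  intros Hrho HD. set (F := orbit lam n) in *.
  assert (Hin : forall u, Cmod u < rho -> Cmod (u + z0 - z0)%C < rho).
  { intros u Hu. now replace (u + z0 - z0)%C with u by ring. }
  assert (Hsq : forall v, fst v < Cmod v -> 0 < Cmod (- v) + fst (- v)%C).
  { intros v Hv. rewrite Cmod_opp. simpl. lra. }
  assert (cs : forall u : C, ccont (fun u : C_UniformSpace => u + z0)%C (u : C_UniformSpace)).
  { intros u. apply ccont_plus; [apply ccont_id | apply ccont_const]. }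
  pose (H := fun u => csqrt (- F (u + z0)%C)).
  pose (dH := fun u => (/ (H u + H u) * (- (1) * dorbit lam n (u + z0)))%C).
  assert (hH : forall u, Cmod u < rho -> cderiv H u (dH u)).
  { intros u Hu. destruct (HD _ (Hin u Hu)) as [h1 h2].
    apply (cderiv_comp csqrt (fun u => - F (u + z0))%C); [now apply cderiv_csqrt, Hsq|].
    apply (cderiv_ext (fun u => - (1) * F (u + z0))%C); [intros; ring|].
    eapply cderiv_eq.
    - apply (cderiv_mult (fun _ => - (1))%C (fun u => F (u + z0)%C)); [apply cderiv_const|].
      apply (cderiv_comp F (fun u => u + z0)%C); [now apply orbit_cderiv|].
      apply cderiv_plus; [apply cderiv_id | apply cderiv_const].
    - ring. }
  assert (hN : forall u, Cmod u < rho -> (H u + H u)%C <> 0).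
  { intros u Hu E. destruct (HD _ (Hin u Hu)) as [h1 h2].
    apply Hsq, csqrt_fst_pos in h2. apply (f_equal fst) in E. unfold H in E. simpl in *. lra. }
  assert (B : Cmod (dH 0) * rho <= 8 * fst (H 0)).
  { apply (schwarz_half_plane H dH rho); [easy| | |easy].
    - intros u Hu. assert (c1 := cderiv_ccont _ _ _ (hH u Hu)).
      assert (c2 : ccont (fun u : C_UniformSpace => dorbit lam n (u + z0)%C) (u : C_UniformSpace)).
      { apply (ccont_comp (dorbit lam n) (fun u : C_UniformSpace => u + z0)%C); [|apply cs].
        apply dorbit_ccont, HD, Hin, Hu. }
      unfold dH. ccont_auto. now apply hN.
    - intros u Hu. destruct (HD _ (Hin u Hu)) as [h1 h2]. now apply csqrt_fst_pos, Hsq. }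
  assert (H0 : Cmod 0 < rho) by (rewrite Cmod_0; lra).
  destruct (HD _ (Hin 0 H0)) as [_ h2]. assert (n0 := hN 0 H0).
  unfold dH in B. rewrite Cmod_mult, Cmod_inv, Cmod_mult, Cmod_opp, Cmod_1, Rmult_1_l in B by easy.
  replace (0 + z0)%C with z0 in * by ring.
  assert (E0 : H 0 = csqrt (- F z0)) by (unfold H; now replace (0 + z0)%C with z0 by ring).
  apply Hsq in h2. assert (E1 := csqrt_sq _ h2). assert (P := csqrt_fst_pos _ h2).
  rewrite <- E0 in *. set (p := H 0) in *.
  assert (m2 : Cmod (p + p) = 2 * Cmod p).
  { replace (p + p)%C with (2 * p)%C by ring. rewrite Cmod_mult, Cmod_R, Rabs_pos_eq; lra. }
  assert (mp : 0 < Cmod p) by (generalize (fst_le_Cmod p); lra).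
  assert (E2 : Cmod (F z0) = Cmod p * Cmod p) by (rewrite <- Cmod_mult, E1, Cmod_opp; easy).
  assert (E3 : fst p ^ 2 = (Cmod (F z0) - fst (F z0)) / 2).
  { rewrite E0. unfold csqrt; simpl fst. rewrite pow2_sqrt; [|simpl in h2; simpl; lra].
    rewrite Cmod_opp. simpl. lra. }
  rewrite m2 in B. set (D := Cmod (dorbit lam n z0)) in *.
  assert (B2 : D * rho <= 16 * (Cmod p * fst p)).
  { apply Rmult_le_reg_l with (/ (2 * Cmod p)); [apply Rinv_0_lt_compat; lra|].
    replace (/ (2 * Cmod p) * (16 * (Cmod p * fst p))) with (8 * fst p) by (field; lra). lra. }
  assert (D0 : 0 <= D) by apply Cmod_ge_0.
  replace (D ^ 2 * rho ^ 2) with ((D * rho) ^ 2) by ring.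
  replace (128 * (Cmod (F z0) * (Cmod (F z0) - fst (F z0)))) with ((16 * (Cmod p * fst p)) ^ 2).
  - apply pow_incr. split; [nra | easy].
  - rewrite E2 at 1. replace (Cmod (F z0) - fst (F z0)) with (2 * fst p ^ 2) by lra. ring.
Qed.

(** * The basin *)

Lemma zeta_real (lam x : R) : x + 1 <> 0 -> zeta lam (RtoC x) = RtoC (zetaR lam x).
Proof.
  intros Hx. unfold zeta, Cexp, zetaR. apply C_ext; simpl;
  replace (- 0) with 0 by ring; rewrite cos_0, sin_0; field; (split; [|easy]) || idtac; nra.
Qed.

(** Cancelling [a] in the fixed point equation leaves [lam = (a + 1) exp a]. As [lam > 0] forces
    [a > -1], where the right side increases, the two bounds on [lam] become [0 < a < sqrt 2]. *)
Lemma zetah_fixed_real (lam a : R) : 1 < lam -> lam < (sqrt 2 + 1) * exp (sqrt 2) -> a <> 0 ->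
  zetah lam (Some (RtoC a)) = Some (RtoC a) -> 0 < a < sqrt 2 /\ lam = (a + 1) * exp a.
Proof.
  intros H1 H2 Ha E.
  assert (Hm1 : RtoC a <> RtoC (-1)).
  { intros Em. rewrite Em, zetah_pole in E. discriminate. }
  assert (Hm1' : a + 1 <> 0) by (intros h; apply Hm1; f_equal; lra).
  rewrite zetah_Some, zeta_real in E by easy.
  apply (f_equal (fun w => match w with Some z => fst z | None => 0 end)) in E. simpl in E.
  assert (Hex := exp_pos a).
  assert (EL : lam = (a + 1) * exp a).
  { unfold zetaR in E. rewrite exp_Ropp in E.
    apply (f_equal (fun t => t * (a + 1) * exp a / a)) in E.
    replace (lam * (a / (a + 1)) * / exp a * (a + 1) * exp a / a) with lam in E
      by (field; repeat split; lra).
    rewrite E. field. easy. }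
  split; [|easy].
  assert (Ha1 : 0 < a + 1) by nra.
  assert (Ha0 : 0 < a).
  { destruct (Rlt_dec 0 a); [easy|]. exfalso.
    assert (exp a < 1) by (rewrite <- exp_0; apply exp_increasing; lra). nra. }
  split; [easy|]. apply Rnot_le_lt. intros h.
  assert (exp (sqrt 2) <= exp a) by (destruct h as [h| ->]; [left; now apply exp_increasing | lra]).
  generalize sqrt2_gt1 (exp_pos (sqrt 2)). nra.
Qed.

Section Basin.
Context (lam a : R).
Hypotheses (Ha : 0 < a) (Ha2 : a < sqrt 2) (Elam : lam = (a + 1) * exp a) (Hlam : 1 < lam).

(** The basin in terms of the total map [zeta], so that derivatives and continuity in [C] apply. *)
Definition attracted (z : C) : Prop :=
  (forall n, no_pole lam n z) /\
  forall eps, 0 < eps -> exists N, forall n, (N <= n)%nat -> Cmod (orbit lam n z - RtoC a) < eps.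

Lemma basin_attracted (z : C) : basin lam (RtoC a) (Some z) <-> attracted z.
Proof.
  split.
  - intros (_ & H1 & H2).
    assert (H3 : forall n, no_pole lam n z) by (intros n; now apply iterh_no_pole).
    split; [easy|]. intros eps Heps. destruct (H2 eps Heps) as [N HN]. exists N. intros n Hn.
    destruct (HN n Hn) as (zn & E & Hzn). rewrite iterh_Some in E by easy. now injection E as ->.
  - intros [H1 H2]. split; [now exists z|]. split.
    + intros n. now rewrite iterh_Some.
    + intros eps Heps. destruct (H2 eps Heps) as [N HN]. exists N. intros n Hn.
      exists (orbit lam n z). split; [now apply iterh_Some | now apply HN].
Qed.

Lemma attracted_orbit (m : nat) (z : C) : no_pole lam m z -> attracted (orbit lam m z) -> attracted z.
Proof.
  intros Hm [H1 H2]. split.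
  - intros n k Hk. apply (no_pole_add lam n m z Hm (H1 n)). lia.
  - intros eps Heps. destruct (H2 eps Heps) as [N HN]. exists (N + m)%nat. intros n Hn.
    replace n with ((n - m) + m)%nat by lia. rewrite orbit_add. apply HN. lia.
Qed.

Lemma attracted_positive (x : R) : 0 < x -> attracted (RtoC x).
Proof.
  intros Hx.
  assert (P : forall n, 0 < Nat.iter n (zetaR lam) x).
  { intros n. induction n as [|n IH]; simpl; [easy | apply zetaR_pos; lra]. }
  assert (E : forall n, orbit lam n (RtoC x) = RtoC (Nat.iter n (zetaR lam) x)).
  { intros n. induction n as [|n IH]; [easy|]. unfold orbit in *. simpl Nat.iter.
    rewrite IH. apply zeta_real. specialize (P n). lra. }
  split.
  - intros n k _ Ek. rewrite E in Ek. apply (f_equal fst) in Ek. simpl in Ek. specialize (P k). lra.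
  - intros eps Heps. assert (L := zetaR_orbit_cv lam a Ha Ha2 Elam x Hx).
    apply is_lim_seq_spec in L. destruct (L (mkposreal _ Heps)) as [N HN]. exists N. intros n Hn.
    rewrite E, <- RtoC_minus, Cmod_R. now apply HN.
Qed.

Lemma attracting_disc : exists rho kappa, 0 < rho /\ 0 <= kappa < 1 /\
  forall z, Cmod (z - RtoC a) < rho ->
    z <> RtoC (-1) /\ Cmod (zeta lam z - RtoC a) <= kappa * Cmod (z - RtoC a).
Proof.
  assert (Hm1 : RtoC a <> RtoC (-1)) by (intros E; apply (f_equal fst) in E; simpl in E; lra).
  destruct (cderiv_zeta lam (RtoC a) Hm1) as (phi & Hphi & E & Hloc).
  (* This multiplier is below 1 because [a > 0], and above -1 because [a^2 < 2]. *)
  assert (Ed : dzeta lam (RtoC a) = RtoC ((1 - a - a ^ 2) / (a + 1))).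
  { unfold dzeta. rewrite Elam. unfold Cexp. assert (h := exp_pos a).
    apply C_ext; simpl; replace (- 0) with 0 by ring; rewrite cos_0, sin_0, exp_Ropp; field; split; nra. }
  set (m := Rabs ((1 - a - a ^ 2) / (a + 1))).
  assert (Hm : 0 <= m < 1).
  { split; [apply Rabs_pos|]. apply Rabs_def1; [apply Rlt_div_l | apply Rlt_div_r]; try lra; [nra|].
    generalize sqrt2_sq sqrt2_gt1; nra. }
  assert (Ephi : Cmod (phi (RtoC a)) = m) by (rewrite E, Ed, Cmod_R; easy).
  destruct (proj1 (ccont_eps phi (RtoC a)) Hphi ((1 - m) / 2)) as (d1 & Hd1 & H1); [lra|].
  apply locally_C_Cmod in Hloc. destruct Hloc as (d2 & Hd2 & H2).
  (* The bound 1 keeps the disc away from the pole; the contraction factor lies halfway between the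
     multiplier and 1. *)
  exists (Rmin d1 (Rmin d2 1)), ((1 + m) / 2).
  split; [repeat apply Rmin_pos; lra|]. split; [lra|]. intros z Hz.
  assert (h1 := Rmin_l d1 (Rmin d2 1)). assert (h2 := Rmin_r d1 (Rmin d2 1)).
  assert (h3 := Rmin_l d2 1). assert (h4 := Rmin_r d2 1).
  split.
  - intros ->. rewrite <- RtoC_minus, Cmod_R, Rabs_left in Hz by lra. lra.
  - assert (Ea : zeta lam (RtoC a) = RtoC a) by (rewrite zeta_real, zetaR_fixed; lra || easy).
    rewrite <- Ea at 1. rewrite H2, Cmod_mult by lra.
    apply Rmult_le_compat_r; [apply Cmod_ge_0|].
    specialize (H1 z ltac:(lra)).
    replace (phi z) with ((phi z - phi (RtoC a)) + phi (RtoC a))%C by ring.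
    generalize (Cmod_triangle (phi z - phi (RtoC a)) (phi (RtoC a))). lra.
Qed.

Lemma trapped (rho kappa : R) (z : C) : 0 < rho -> 0 <= kappa < 1 ->
  (forall z, Cmod (z - RtoC a) < rho ->
    z <> RtoC (-1) /\ Cmod (zeta lam z - RtoC a) <= kappa * Cmod (z - RtoC a)) ->
  Cmod (z - RtoC a) < rho ->
  forall n, no_pole lam n z /\ Cmod (orbit lam n z - RtoC a) <= kappa ^ n * rho.
Proof.
  intros Hr Hk H Hz n.
  enough (no_pole lam n z /\ Cmod (orbit lam n z - RtoC a) <= kappa ^ n * rho /\
    Cmod (orbit lam n z - RtoC a) < rho) by easy.
  induction n as [|n (IH1 & IH2 & IH3)].
  - split; [intros k h; lia|]. simpl. split; lra.
  - destruct (H _ IH3) as [h1 h2]. split; [now apply no_pole_S|].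
    change (orbit lam (S n) z) with (zeta lam (orbit lam n z)).
    assert (h3 := Cmod_ge_0 (orbit lam n z - RtoC a)). simpl. split; nra.
Qed.

(** Finitely many iterates carry a neighbourhood into the attracting disc, where the convergence is
    geometric. The uniformity yields both openness of the basin and normality on it. *)
Lemma attracted_uniform (z : C) : attracted z ->
  exists d, 0 < d /\ (forall w, Cmod (w - z) < d -> forall n, no_pole lam n w) /\
  forall eps, 0 < eps -> exists N, forall n, (N <= n)%nat ->
    forall w, Cmod (w - z) < d -> Cmod (orbit lam n w - RtoC a) < eps.
Proof.
  intros [H1 H2]. destruct attracting_disc as (rho & kappa & Hr & Hk & HT).
  assert (Hr2 : 0 < rho / 2) by lra.
  destruct (H2 _ Hr2) as [m Hm]. specialize (Hm m ltac:(lia)).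
  destruct (proj1 (ccont_eps _ _) (orbit_ccont lam m z (H1 m)) _ Hr2) as (d1 & Hd1 & h1).
  destruct (proj1 (locally_C_Cmod z _) (no_pole_locally lam m z (H1 m))) as (d2 & Hd2 & h2).
  assert (Hin : forall w, Cmod (w - z) < Rmin d1 d2 ->
    no_pole lam m w /\ Cmod (orbit lam m w - RtoC a) < rho).
  { intros w Hw. assert (m1 := Rmin_l d1 d2). assert (m2 := Rmin_r d1 d2).
    split; [apply h2; lra|]. specialize (h1 w ltac:(lra)).
    replace (orbit lam m w - RtoC a)%C with
      ((orbit lam m w - orbit lam m z) + (orbit lam m z - RtoC a))%C by ring.
    eapply Rle_lt_trans; [apply Cmod_triangle | lra]. }
  exists (Rmin d1 d2). split; [now apply Rmin_pos|]. split.
  - intros w Hw n k Hk'. destruct (Hin w Hw) as [i1 i2].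
    apply (no_pole_add lam n m w i1); [|lia]. now apply (trapped rho kappa).
  - intros eps Heps. destruct (pow_lt_1_zero kappa) with (y := eps / rho) as [N HN].
    + rewrite Rabs_pos_eq; lra.
    + now apply Rdiv_lt_0_compat.
    + exists (N + m)%nat. intros n Hn w Hw. destruct (Hin w Hw) as [i1 i2].
      replace n with ((n - m) + m)%nat by lia. rewrite orbit_add.
      destruct (trapped rho kappa _ Hr Hk HT i2 (n - m)) as [_ b].
      eapply Rle_lt_trans; [apply b|]. specialize (HN (n - m)%nat ltac:(lia)).
      rewrite Rabs_pos_eq in HN by (apply pow_le; lra).
      apply Rlt_div_r in HN; lra.
Qed.

Lemma attracted_open (z : C) : attracted z ->
  exists d, 0 < d /\ forall w, Cmod (w - z) < d -> attracted w.
Proof.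
  intros (d & Hd & H1 & H2)%attracted_uniform. exists d. split; [easy|]. intros w Hw.
  split; [now apply H1|]. intros eps Heps. destruct (H2 eps Heps) as [N HN].
  exists N. intros n Hn. now apply HN.
Qed.

Lemma attracted_near_segment (u v : R) : 0 < u ->
  exists eps, 0 < eps /\ forall t z, u <= t <= v -> Cmod (z - RtoC t) < eps -> attracted z.
Proof.
  intros Hu.
  (* The factor 2 lets one radius [d] work on the whole segment: [t] is within [delta s] of some
     [s], and [z] within [d <= delta s] of [t]. *)
  assert (Hex : forall t, exists d : posreal, 0 < t -> forall w, Cmod (w - RtoC t) < 2 * d -> attracted w).
  { intros t. destruct (Rlt_dec 0 t) as [Ht|Ht]; [|now exists (mkposreal 1 Rlt_0_1)].
    destruct (attracted_open _ (attracted_positive t Ht)) as (d & Hd & H).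
    assert (Hd2 : 0 < d / 2) by lra. exists (mkposreal _ Hd2). intros _ w Hw. apply H.
    simpl in Hw. lra. }
  set (delta := fun t => proj1_sig (constructive_indefinite_description _ (Hex t))).
  assert (Hdelta : forall t, 0 < t -> forall w, Cmod (w - RtoC t) < 2 * delta t -> attracted w).
  { intros t. unfold delta. now destruct (constructive_indefinite_description _ (Hex t)). }
  destruct (compactness_value_1d u v delta) as [d Hd]. exists d. split; [apply cond_pos|].
  intros t z Ht Hz. apply NNPP. intros Hn. apply (Hd t Ht). intros (s & Hs & H1 & H2).
  apply Hn. apply (Hdelta s); [lra|].
  replace (z - RtoC s)%C with ((z - RtoC t) + RtoC (t - s))%C by (rewrite RtoC_minus; ring).
  eapply Rle_lt_trans; [apply Cmod_triangle|]. rewrite Cmod_R. lra.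
Qed.

(** The upper bound prevents an orbit near 0 from jumping in one step to the far region of
    [no_free_disc]. *)
Lemma zeta_repels_zero : exists r0 kappa, 0 < r0 <= 1 / 2 /\ 1 < kappa /\
  forall z, Cmod z < r0 -> kappa * Cmod z <= Cmod (zeta lam z) <= 4 * lam * r0.
Proof.
  (* [kappa > 1] requires [r0 < (lam - 1) / (lam + 1)], and half of that is taken. The bound [1 / 2]
     makes both [exp (- fst z)] and [1 / |z + 1|] at most 2, hence the factor 4. *)
  set (r0 := Rmin (1 / 2) ((lam - 1) / (2 * (lam + 1)))).
  assert (h1 : r0 <= 1 / 2) by apply Rmin_l.
  assert (h2 : r0 * (2 * (lam + 1)) <= lam - 1).
  { apply Rle_div_r; [lra | apply Rmin_r]. }
  assert (h0 : 0 < r0) by (apply Rmin_pos; [lra | apply Rdiv_lt_0_compat; lra]).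
  exists r0, (lam * ((1 - r0) / (1 + r0))). split; [lra|]. split.
  - replace (lam * ((1 - r0) / (1 + r0))) with ((lam * (1 - r0)) / (1 + r0)) by (field; lra).
    apply Rlt_div_r; nra.
  - intros z Hz. assert (Hx := fst_le_Cmod z). assert (Hz0 := Cmod_ge_0 z).
    assert (Hm1 : z <> RtoC (-1)).
    { intros ->. rewrite Cmod_R, Rabs_left in Hz; lra. }
    assert (Hs1 : Cmod (z + 1) <= 1 + r0).
    { eapply Rle_trans; [apply Cmod_triangle|]. rewrite Cmod_1. lra. }
    assert (Hs2 : 1 - r0 <= Cmod (z + 1)).
    { generalize (fst_le_Cmod (z + 1)%C). simpl. lra. }
    assert (He1 : 1 - r0 <= exp (- fst z)) by (generalize (exp_ineq1_le (- fst z)); lra).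
    assert (He2 : exp (- fst z) <= 2).
    { assert (q : exp (fst z) * exp (- fst z) = 1) by (rewrite <- exp_plus, Rplus_opp_r; apply exp_0).
      generalize (exp_ineq1_le (fst z)) (exp_pos (- fst z)). nra. }
    rewrite Cmod_zeta by (easy || lra).
    set (s := Cmod (z + 1)) in *. set (E := exp (- fst z)) in *. set (r := Cmod z) in *.
    assert (is1 : / (1 + r0) <= / s) by (apply Rinv_le_contravar; lra).
    assert (is2 : / s <= 2) by (replace 2 with (/ (1 / 2)) by field; apply Rinv_le_contravar; lra).
    assert (0 < / (1 + r0)) by (apply Rinv_0_lt_compat; lra).
    unfold Rdiv. split.
    + replace (lam * ((1 - r0) * / (1 + r0)) * r) with (lam * r * (/ (1 + r0) * (1 - r0))) by ring.
      replace (lam * (r * / s) * E) with (lam * r * (/ s * E)) by ring.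
      apply Rmult_le_compat_l; [nra|]. apply Rmult_le_compat; lra.
    + replace (lam * (r * / s) * E) with (lam * (r * (/ s * E))) by ring.
      replace (4 * lam * r0) with (lam * (r0 * (2 * 2))) by ring.
      apply Rmult_le_compat_l; [lra|]. apply Rmult_le_compat; try lra; [|apply Rmult_le_compat; lra].
      apply Rmult_le_pos; lra.
Qed.

(** * Discs that miss the basin *)

Section FreeDisc.
Context (z0 : C) (rho : R).
Hypotheses (Hrho : 0 < rho)
  (Hfree : forall v, Cmod (v - z0) < rho -> (forall n, no_pole lam n v) /\ ~ attracted v).

(** A positive iterate would put [v] in the basin. An iterate equal to 0 forces [v = 0], since
    [zeta] vanishes nowhere else; but then the disc contains small positive reals, which are
    attracted. *)
Local Lemma in_slit_plane (v : C) (n : nat) : Cmod (v - z0) < rho ->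
  fst (orbit lam n v) < Cmod (orbit lam n v).
Proof.
  intros Hv. apply Rnot_le_lt. intros Hle.
  destruct (Hfree v Hv) as [Hp Ha'].
  set (u := orbit lam n v) in *.
  assert (Eu : u = RtoC (Cmod u)).
  { generalize (fst_le_Cmod u) (Cmod_sq u). intros h1 h2. apply C_ext; simpl; nra. }
  destruct (Cmod_ge_0 u) as [Hu|Hu].
  - apply Ha', (attracted_orbit n); [easy|]. fold u. rewrite Eu. now apply attracted_positive.
  - assert (Hv0 : v = 0).
    { apply NNPP. intros hv.
      assert (Hn : forall k, orbit lam k v <> 0).
      { intros k. induction k as [|k IH]; [easy|]. apply zeta_neq_0; [lra| |easy].
        apply (Hp (S k)). lia. }
      apply (Hn n). fold u. now rewrite Eu, <- Hu. }
    subst v. replace (0 - z0)%C with (- z0)%C in Hv by ring. rewrite Cmod_opp in Hv.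
    set (t := (rho - Cmod z0) / 2).
    assert (Ht : 0 < t) by (unfold t; lra).
    apply (Hfree (RtoC t)); [|now apply attracted_positive].
    eapply Rle_lt_trans; [apply Cmod_triangle|]. rewrite Cmod_opp, Cmod_R, Rabs_pos_eq by lra.
    unfold t. lra.
Qed.

Local Notation zn n := (orbit lam n z0).
Let dens (n : nat) : R := Cmod (zn n) * (Cmod (zn n) - fst (zn n)).
(** Up to a factor depending only on [z0], the squared hyperbolic derivative of the [n]-th iterate
    at [z0]. *)
Let growth (n : nat) : R := Cmod (dorbit lam n z0) ^ 2 / dens n.

Local Lemma z0_in : Cmod (z0 - z0) < rho.
Proof. replace (z0 - z0)%C with (RtoC 0) by ring. rewrite Cmod_0. easy. Qed.

Local Lemma dens_pos (n : nat) : 0 < dens n.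
Proof.
  assert (h := in_slit_plane z0 n z0_in). assert (h' := fst_le_Cmod (zn n)). unfold dens.
  apply Rmult_lt_0_compat; lra.
Qed.

Local Lemma growth_bounded (n : nat) : growth n <= 128 / rho ^ 2.
Proof.
  assert (h := schwarz_orbit lam n z0 rho Hrho). specialize (h (fun v Hv =>
    conj (proj1 (Hfree v Hv) n) (in_slit_plane v n Hv))).
  unfold growth. assert (p := dens_pos n). apply Rle_div_l; [easy|].
  replace (128 / rho ^ 2 * dens n) with (128 * dens n / rho ^ 2) by (field; lra).
  apply (Rle_div_r _ _ (rho ^ 2)); [apply pow_lt; lra | exact h].
Qed.

Local Lemma growth_step (n : nat) (e r0 : R) : 0 <= e <= 1 -> 0 <= r0 <= 1 ->
  r0 <= Cmod (zn n) -> fst (zn n) <= (1 - e) * Cmod (zn n) ->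
  (1 + r0 ^ 4 * e ^ 2 / 32) * growth n <= growth (S n).
Proof.
  intros He Hr0 h1 h2.
  assert (Hp : zn n <> RtoC (-1)) by (apply (proj1 (Hfree z0 z0_in) (S n)); lia).
  generalize (zeta_expands lam (zn n) e r0 ltac:(lra) Hp (in_slit_plane z0 n z0_in) He Hr0 h1 h2).
  fold (dens n). change (zeta lam (zn n)) with (zn (S n)). fold (dens (S n)).
  intros HM. assert (p1 := dens_pos n). assert (p2 := dens_pos (S n)).
  unfold growth. simpl dorbit. rewrite Cmod_mult, Rpow_mult_distr.
  set (A := Cmod (dorbit lam n z0) ^ 2). assert (0 <= A) by apply pow2_ge_0.
  apply (Rle_div_r _ _ (dens (S n))); [easy|].
  replace ((1 + r0 ^ 4 * e ^ 2 / 32) * (A / dens n) * dens (S n)) with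
    ((A / dens n) * ((1 + r0 ^ 4 * e ^ 2 / 32) * dens (S n))) by (field; lra).
  replace (Cmod (dzeta lam (zn n)) ^ 2 * A) with
    ((A / dens n) * (Cmod (dzeta lam (zn n)) ^ 2 * dens n)) by (field; lra).
  apply Rmult_le_compat_l; [|easy]. now apply Rdiv_le_0_compat.
Qed.

(** The case [e = r0 = 0] of [growth_step], whose factor is 1. *)
Local Lemma growth_mono (n m : nat) : (n <= m)%nat -> growth n <= growth m.
Proof.
  induction 1 as [|m _ IH]; [lra|]. eapply Rle_trans; [apply IH|].
  generalize (growth_step m 0 0). generalize (Cmod_ge_0 (zn m)) (fst_le_Cmod (zn m)). intros.
  enough ((1 + 0 ^ 4 * 0 ^ 2 / 32) * growth m <= growth (S m)) by lra.
  apply growth_step; lra.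
Qed.

(** Each visit outside these regions multiplies [growth] by at least [1 + d], and no step decreases
    it; the bound from Schwarz's lemma allows only finitely many visits. *)
Lemma eventually_near_axis (e r0 : R) : 0 < e <= 1 -> 0 < r0 <= 1 ->
  exists N, forall n, (N <= n)%nat -> Cmod (zn n) < r0 \/ (1 - e) * Cmod (zn n) < fst (zn n).
Proof.
  intros He Hr0. apply NNPP. intros Hn.
  assert (Hinf : forall N, exists n, (N <= n)%nat /\ r0 <= Cmod (zn n) /\ fst (zn n) <= (1 - e) * Cmod (zn n)).
  { intros N. apply NNPP. intros h. apply Hn. exists N. intros n HNn.
    destruct (Rlt_dec (Cmod (zn n)) r0) as [h1|h1]; [now left | right].
    apply Rnot_le_lt. intros h2. apply h. exists n. repeat split; lra || easy. }
  set (d := r0 ^ 4 * e ^ 2 / 32).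
  assert (Hd : 0 < d).
  { unfold d. assert (0 < r0 ^ 4) by (apply pow_lt; lra). assert (0 < e ^ 2) by (apply pow_lt; lra). nra. }
  assert (g0 : 0 < growth 0).
  { unfold growth. simpl dorbit. rewrite Cmod_1. apply Rdiv_lt_0_compat; [lra | apply dens_pos]. }
  assert (Hk : forall k, exists n, (1 + d) ^ k * growth 0 <= growth n).
  { intros k. induction k as [|k (n & IH)]; [exists O; simpl; lra|].
    destruct (Hinf n) as (m & Hm & h1 & h2). exists (S m).
    apply Rle_trans with ((1 + d) * growth m); [|apply growth_step; lra].
    simpl. rewrite Rmult_assoc. apply Rmult_le_compat_l; [lra|].
    apply Rle_trans with (growth n); [easy | now apply growth_mono]. }
  set (B := 128 / rho ^ 2).
  assert (HB : 0 <= B) by (apply Rdiv_le_0_compat; nra).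
  assert (Hdg : 0 < d * growth 0) by nra.
  destruct (INR_unbounded (B / (d * growth 0))) as [k hk].
  destruct (Hk k) as [n hn]. assert (b := growth_bounded n). fold B in b.
  assert (p := poly k d Hd). apply Rgt_lt, Rlt_div_l in hk; [|lra]. nra.
Qed.

Lemma no_free_disc : False.
Proof.
  destruct zeta_repels_zero as (r0 & kappa & Hr0 & Hkappa & Hrep).
  (* Beyond [R0], with real part at least half the modulus, [exp t >= t] bounds the image by
     [2 lam / R0 = r0 / 2]. From the disc of radius [r0] the image has modulus at most
     [4 lam r0 < R0]. *)
  set (R0 := 4 * lam / r0).
  assert (HR0 : R0 * r0 = 4 * lam) by (unfold R0; field; lra).
  assert (HR0' : 4 * lam <= R0) by nra.
  destruct (attracted_near_segment r0 R0) as (eps & Heps & Hseg); [lra|].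
  (* For [|u| <= R0] in the sector, [|u - |u||^2 = 2 |u| (|u| - Re u) <= 2 e R0^2 <= eps^2 / 2], so
     [u] is attracted. The bound [1 / 2] gives real part at least half the modulus. *)
  set (e := Rmin (1 / 2) (eps ^ 2 / (4 * R0 ^ 2))).
  assert (He1 : e <= 1 / 2) by apply Rmin_l.
  assert (He2 : e * (4 * R0 ^ 2) <= eps ^ 2).
  { apply Rle_div_r; [nra | apply Rmin_r]. }
  assert (He0 : 0 < e) by (apply Rmin_pos; [lra | apply Rdiv_lt_0_compat; nra]).
  destruct (eventually_near_axis e r0) as [N HN]; [lra | lra|].
  assert (Hp : forall n, zn n <> RtoC (-1)) by (intros n; apply (proj1 (Hfree z0 z0_in) (S n)); lia).
  assert (Hdich : forall n, (N <= n)%nat -> Cmod (zn n) < r0 \/ R0 < Cmod (zn n) /\ Cmod (zn n) / 2 <= fst (zn n)).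
  { intros n Hn. destruct (HN n Hn) as [h|h]; [now left|].
    destruct (Rlt_dec (Cmod (zn n)) r0) as [h1|h1]; [now left|].
    destruct (Rlt_dec R0 (Cmod (zn n))) as [h2|h2]; [right; split; [easy | nra]|].
    exfalso. apply (Hfree z0 z0_in). apply (attracted_orbit n); [apply (Hfree z0 z0_in)|].
    set (u := zn n) in *. apply (Hseg (Cmod u)); [lra|].
    assert (Eu : Cmod (u - RtoC (Cmod u)) ^ 2 = 2 * Cmod u * (Cmod u - fst u)).
    { rewrite Cmod_sq. simpl. generalize (Cmod_sq u). simpl. nra. }
    assert (Hu : Cmod u * (Cmod u - fst u) <= e * R0 ^ 2).
    { apply Rle_trans with (Cmod u * (e * Cmod u)); [apply Rmult_le_compat_l; nra|].
      assert (Cmod u * Cmod u <= R0 * R0) by (apply Rmult_le_compat; lra). nra. }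
    assert (c := Cmod_ge_0 (u - RtoC (Cmod u))). nra. }
  assert (Hfar : forall n, R0 < Cmod (zn n) -> Cmod (zn n) / 2 <= fst (zn n) -> Cmod (zn (S n)) < r0).
  { intros n h1 h2. change (zn (S n)) with (zeta lam (zn n)). rewrite Cmod_zeta by (easy || lra).
    set (u := zn n) in *.
    assert (Hs : Cmod u <= Cmod (u + 1)).
    { apply Rsqr_incr_0_var; [|apply Cmod_ge_0]. generalize (Cmod_sq u) (Cmod_sq (u + 1)%C). simpl. unfold Rsqr. nra. }
    assert (Hq : Cmod u / Cmod (u + 1) <= 1) by (apply Rle_div_l; lra).
    assert (He : exp (- fst u) * (R0 / 2) <= 1).
    { assert (q : exp (fst u) * exp (- fst u) = 1) by (rewrite <- exp_plus, Rplus_opp_r; apply exp_0).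
      generalize (exp_ineq1_le (fst u)) (exp_pos (- fst u)). nra. }
    assert (p := exp_pos (- fst u)).
    apply Rle_lt_trans with (lam * 1 * exp (- fst u)).
    - apply Rmult_le_compat_r; [lra|]. apply Rmult_le_compat_l; lra.
    - apply Rmult_lt_reg_r with (R0 / 2); [lra|].
      apply Rle_lt_trans with (lam * 1); nra. }
  assert (Hnear : forall n, (N <= n)%nat -> Cmod (zn n) < r0 -> Cmod (zn (S n)) < r0).
  { intros n Hn h. destruct (Hdich (S n)) as [h1|[h1 _]]; [lia | easy|].
    destruct (Hrep _ h) as [_ h2]. change (zeta lam (zn n)) with (zn (S n)) in h2. nra. }
  assert (HM : exists M, forall k, Cmod (zn (k + M)) < r0).
  { assert (H0 : exists M, (N <= M)%nat /\ Cmod (zn M) < r0).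
    { destruct (Hdich N) as [h|[h1 h2]]; [lia | now exists N|].
      exists (S N). split; [lia | now apply Hfar]. }
    destruct H0 as (M & HM1 & HM2). exists M. intros k. induction k as [|k IH]; [easy|].
    apply (Hnear (k + M)%nat); [lia | easy]. }
  destruct HM as [M HM].
  assert (Hgrow : forall k, kappa ^ k * Cmod (zn M) <= Cmod (zn (k + M))).
  { intros k. induction k as [|k IH]; [simpl; lra|].
    change (zn (S k + M)) with (zeta lam (zn (k + M))).
    apply Rle_trans with (kappa * Cmod (zn (k + M))); [|apply Hrep, HM].
    simpl pow. rewrite Rmult_assoc. apply Rmult_le_compat_l; lra. }
  assert (Hpos : 0 < Cmod (zn M)).
  { generalize (in_slit_plane z0 M z0_in) (fst_le_Cmod (zn M)). lra. }
  destruct (Pow_x_infinity kappa) with (b := r0 / Cmod (zn M)) as [k hk].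
  { rewrite Rabs_pos_eq; lra. }
  specialize (hk k (le_n k)). rewrite Rabs_pos_eq in hk by (apply pow_le; lra).
  apply Rge_le, Rle_div_l in hk; [|easy]. specialize (HM k). specialize (Hgrow k). lra.
Qed.
End FreeDisc.
End Basin.

(** * Chordal metric and the Fatou set *)

Lemma one_plus_sq_ge1 (z : C) : 1 <= 1 + Cmod z ^ 2.
Proof. generalize (pow2_ge_0 (Cmod z)); lra. Qed.

Lemma Cmod_minus_sym (z u : C) : Cmod (z - u) = Cmod (u - z).
Proof. rewrite <- Cmod_opp. f_equal. ring. Qed.

Lemma sigma_sym (w v : Chat) : sigma w v = sigma v w.
Proof.
  destruct w as [z|], v as [u|]; simpl; try easy.
  now rewrite Cmod_minus_sym, (Rmult_comm (1 + _)).
Qed.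

Lemma sigma_refl (w : Chat) : sigma w w = 0.
Proof.
  destruct w as [z|]; simpl; [|easy]. replace (z - z)%C with (RtoC 0) by ring.
  rewrite Cmod_0. unfold Rdiv. ring.
Qed.

Lemma sigma_le_dist (z u : C) : sigma (Some z) (Some u) <= 2 * Cmod (z - u).
Proof.
  simpl. generalize (one_plus_sq_ge1 z) (one_plus_sq_ge1 u) (Cmod_ge_0 (z - u)); simpl; intros h1 h2 h3.
  set (q := sqrt _). assert (hq : 1 <= q).
  { rewrite <- sqrt_1. apply sqrt_le_1_alt. nra. }
  apply Rle_div_l; nra.
Qed.

Lemma sigma_close (v : C) (eps : R) : 0 < eps ->
  exists r, 0 < r /\ forall w, sigma (Some v) w < r -> exists u, w = Some u /\ Cmod (u - v) < eps.
Proof.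
  intros Heps. set (B := sqrt (1 + Cmod v ^ 2)).
  assert (HB : 1 <= B).
  { unfold B. rewrite <- sqrt_1 at 1. apply sqrt_le_1_alt, one_plus_sq_ge1. }
  assert (Hv := Cmod_ge_0 v).
  (* The first bound excludes infinity, at chordal distance [2 / B] from [v]. For finite [u] at
     distance [d], both bounds give [2 d < r B (1 + |v| + d) <= eps + d]. *)
  set (r := Rmin (/ B) (eps / (B * (1 + Cmod v)))).
  assert (hr0 : 0 < r).
  { apply Rmin_pos; [apply Rinv_0_lt_compat; lra | apply Rdiv_lt_0_compat; nra]. }
  assert (hr1 : r * B <= 1).
  { replace 1 with (/ B * B) by (field; lra). apply Rmult_le_compat_r; [lra | apply Rmin_l]. }
  assert (hr2 : r * (B * (1 + Cmod v)) <= eps).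
  { apply (Rle_div_r r _ (B * (1 + Cmod v))); [nra | apply Rmin_r]. }
  exists r. split; [easy|]. intros [u|] Hw.
  - exists u. split; [easy|]. unfold sigma in Hw. rewrite sqrt_mult in Hw by (generalize (one_plus_sq_ge1 v) (one_plus_sq_ge1 u); lra).
    fold B in Hw. rewrite Cmod_minus_sym in Hw. set (d := Cmod (u - v)) in *.
    assert (hd : 0 <= d) by apply Cmod_ge_0.
    assert (hu : Cmod u <= Cmod v + d).
    { replace u with (v + (u - v))%C at 1 by ring. apply Cmod_triangle. }
    assert (hq1 : 1 <= sqrt (1 + Cmod u ^ 2)).
    { rewrite <- sqrt_1 at 1. apply sqrt_le_1_alt, one_plus_sq_ge1. }
    assert (hq : sqrt (1 + Cmod u ^ 2) <= 1 + Cmod v + d).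
    { assert (hu0 := Cmod_ge_0 u). apply Rle_trans with (1 + Cmod u); [|lra].
      rewrite <- (sqrt_pow2 (1 + Cmod u)) by lra. apply sqrt_le_1_alt. nra. }
    apply Rlt_div_l in Hw; [|nra].
    assert (r * (B * sqrt (1 + Cmod u ^ 2)) <= r * B * (1 + Cmod v + d)).
    { rewrite <- Rmult_assoc. apply Rmult_le_compat_l; nra. }
    nra.
  - exfalso. simpl in Hw. change (Cmod v * (Cmod v * 1)) with (Cmod v ^ 2) in Hw. fold B in Hw.
    apply Rlt_div_l in Hw; lra.
Qed.

Lemma increasing_ge (phi : nat -> nat) : (forall k, (phi k < phi (S k))%nat) -> forall k, (k <= phi k)%nat.
Proof. intros H k. induction k as [|k IH]; [lia|]. specialize (H k). lia. Qed.

(** Uniqueness of limits without the triangle inequality for [sigma]: a finite limit is compared in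
    the Euclidean metric, and infinity is at positive chordal distance from any bounded set. *)
Lemma sigma_limit (a : C) (u : nat -> C) (w : Chat) :
  (forall eps, 0 < eps -> exists N, forall n, (N <= n)%nat -> Cmod (u n - a) < eps) ->
  (forall eps, 0 < eps -> exists N, forall n, (N <= n)%nat -> sigma (Some (u n)) w < eps) ->
  w = Some a.
Proof.
  intros H1 H2. destruct w as [b|].
  - f_equal. apply NNPP. intros Hn.
    assert (Hd : 0 < Cmod (b - a)).
    { apply Cmod_gt_0. intros E. apply Hn.
      apply C_ext; [apply (f_equal fst) in E | apply (f_equal snd) in E]; simpl in E; lra. }
    assert (Hd2 : 0 < Cmod (b - a) / 2) by lra.
    destruct (sigma_close b _ Hd2) as (r & Hr & Hc).
    destruct (H1 _ Hd2) as [N1 h1]. destruct (H2 _ Hr) as [N2 h2].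
    specialize (h1 (N1 + N2)%nat ltac:(lia)). specialize (h2 (N1 + N2)%nat ltac:(lia)).
    rewrite sigma_sym in h2. destruct (Hc _ h2) as (x & Ex & hx). injection Ex as <-.
    rewrite Cmod_minus_sym in hx.
    generalize (Cmod_triangle (b - u (N1 + N2)%nat) (u (N1 + N2)%nat - a)).
    replace (b - u (N1 + N2)%nat + (u (N1 + N2)%nat - a))%C with (b - a)%C by ring. lra.
  - exfalso. set (m := 1 + (Cmod a + 1) ^ 2).
    assert (Hm : 0 < m) by (unfold m; nra).
    assert (He : 0 < 2 / sqrt m) by (apply Rdiv_lt_0_compat; [lra | now apply sqrt_lt_R0]).
    destruct (H1 1 Rlt_0_1) as [N1 h1]. destruct (H2 _ He) as [N2 h2].
    specialize (h1 (N1 + N2)%nat ltac:(lia)). specialize (h2 (N1 + N2)%nat ltac:(lia)).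
    set (z := u (N1 + N2)%nat) in *. unfold sigma in h2.
    assert (hz : Cmod z <= Cmod a + 1).
    { replace z with ((z - a) + a)%C by ring. eapply Rle_trans; [apply Cmod_triangle | lra]. }
    assert (hq : sqrt (1 + Cmod z ^ 2) <= sqrt m).
    { apply sqrt_le_1_alt. unfold m. generalize (Cmod_ge_0 z). nra. }
    assert (hq0 : 0 < sqrt (1 + Cmod z ^ 2)) by (apply sqrt_lt_R0; generalize (one_plus_sq_ge1 z); lra).
    assert (/ sqrt m <= / sqrt (1 + Cmod z ^ 2)) by now apply Rinv_le_contravar.
    unfold Rdiv in h2. lra.
Qed.

(** The hypothesis at [S n] is what makes the [n]-th iterate itself finite. *)
Lemma fatou_no_pole (lam : R) (z : C) (U : Chat -> Prop) : U (Some z) ->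
  (forall n v, U v -> iter_defined lam n v) -> forall n, no_pole lam n z.
Proof. intros Hz HU n. apply iterh_no_pole. apply (HU (S n)); [easy | lia]. Qed.

(** * Fatou points are basin points *)

Section FatouBasin.
Context (lam a : R).
Hypotheses (Ha : 0 < a) (Ha2 : a < sqrt 2) (Elam : lam = (a + 1) * exp a) (Hlam : 1 < lam).

(** Normality quantifies over arbitrary sequences [m] of exponents: those repeating a value
    infinitely often have a constant subsequence, the others tend to infinity. *)
Lemma constant_or_divergent (m : nat -> nat) :
  (exists c, forall N, exists k, (N <= k)%nat /\ m k = c) \/
  (forall c, exists N, forall k, (N <= k)%nat -> (c <= m k)%nat).
Proof.
  destruct (classic (exists c, forall N, exists k, (N <= k)%nat /\ m k = c)) as [h|h]; [now left | right].
  intros c. induction c as [|c [N IH]]; [exists O; lia|].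
  assert (Hc : exists N', forall k, (N' <= k)%nat -> m k <> c).
  { apply NNPP. intros h'. apply h. exists c. intros M. apply NNPP. intros h2. apply h'.
    exists M. intros k Hk Ek. apply h2. now exists k. }
  destruct Hc as [N' HN']. exists (N + N')%nat. intros k Hk.
  specialize (IH k ltac:(lia)). specialize (HN' k ltac:(lia)). lia.
Qed.

Lemma attracted_fatou (z0 : C) : attracted lam a z0 -> fatou lam (Some z0).
Proof.
  intros Hz. destruct (attracted_uniform lam a Ha Ha2 Elam z0 Hz) as (d & Hd & H1 & H2).
  set (U := fun v : Chat => exists z, v = Some z /\ Cmod (z - z0) < d).
  assert (HUopen : chat_open U).
  { intros w (z & -> & Hzd). destruct (sigma_close z (d - Cmod (z - z0))) as (r & Hr & Hc); [lra|].
    exists r. split; [easy|]. intros v Hv. destruct (Hc v Hv) as (u & -> & Hu). exists u. split; [easy|].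
    replace (u - z0)%C with ((u - z) + (z - z0))%C by ring.
    eapply Rle_lt_trans; [apply Cmod_triangle | lra]. }
  exists U. split; [easy|]. split; [|split].
  - exists z0. split; [easy|]. replace (z0 - z0)%C with (RtoC 0) by ring. now rewrite Cmod_0.
  - intros n v (z & -> & Hv) k _. rewrite iterh_Some; [discriminate | now apply H1].
  - intros m. destruct (constant_or_divergent m) as [[c Hc]|Hdiv].
    + set (nxt := fun N => proj1_sig (constructive_indefinite_description _ (Hc N))).
      assert (Hnxt : forall N, (N <= nxt N)%nat /\ m (nxt N) = c).
      { intros N. unfold nxt. now destruct (constructive_indefinite_description _ (Hc N)). }
      (* Searching from [S (phi k)] makes the subsequence strictly increasing. *)
      set (phi := fix phi k := match k with O => nxt O | S k => nxt (S (phi k)) end).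
      exists phi. split; [intros k; simpl; apply Hnxt|].
      exists (iterh lam c). intros w Hw. destruct (HUopen w Hw) as (r & Hr & Hball).
      exists r. split; [easy|]. split; [easy|]. intros eps Heps. exists O. intros k _ v _.
      replace (m (phi k)) with c by (destruct k; symmetry; apply Hnxt). now rewrite sigma_refl.
    + exists (fun k => k). split; [lia|]. exists (fun _ => Some (RtoC a)).
      intros w Hw. destruct (HUopen w Hw) as (r & Hr & Hball).
      exists r. split; [easy|]. split; [easy|]. intros eps Heps.
      destruct (H2 (eps / 2)) as [N HN]; [lra|]. destruct (Hdiv N) as [N' HN'].
      exists N'. intros k Hk v Hv. destruct (Hball v Hv) as (z & -> & Hzd).
      rewrite iterh_Some by now apply H1.
      eapply Rle_lt_trans; [apply sigma_le_dist|].
      specialize (HN _ (HN' k Hk) z Hzd). lra.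
Qed.

(** On a ball around [z0] a subsequence converges uniformly, and its limit at basin points is [a].
    So one iterate [n], chosen before [v], brings all basin points of the ball near [a]; continuity
    of that iterate at [z0] brings [z0] near [a] too. *)
Lemma fatou_closure_attracted (z0 : C) : fatou lam (Some z0) ->
  (forall d, 0 < d -> exists v, Cmod (v - z0) < d /\ attracted lam a v) -> attracted lam a z0.
Proof.
  intros (U & _ & Hz0 & Hdef & Hnorm) Hclos.
  destruct (Hnorm (fun n => n)) as (phi & Hphi & g & Hg).
  destruct (Hg _ Hz0) as (r & Hr & Hball & Hunif).
  destruct (attracted_open lam a Ha Ha2 Elam (RtoC a)) as (da & Hda & Hatt); [now apply attracted_positive|].
  assert (Hda2 : 0 < da / 2) by lra.
  destruct (sigma_close (RtoC a) _ Hda2) as (r1 & Hr1 & Hclose).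
  destruct (Hunif r1 Hr1) as [K HK]. specialize (HK K (le_n K)).
  assert (Hnp := fatou_no_pole lam z0 U Hz0 Hdef).
  set (n := phi K) in *.
  destruct (proj1 (ccont_eps _ _) (orbit_ccont lam n z0 (Hnp n)) _ Hda2) as (d1 & Hd1 & Hcont).
  destruct (Hclos (Rmin d1 (r / 2))) as (v & Hv & Hva); [apply Rmin_pos; lra|].
  assert (m1 := Rmin_l d1 (r / 2)). assert (m2 := Rmin_r d1 (r / 2)).
  assert (Hsv : sigma (Some z0) (Some v) < r).
  { eapply Rle_lt_trans; [apply sigma_le_dist|]. rewrite Cmod_minus_sym. lra. }
  assert (Hgv : g (Some v) = Some (RtoC a)).
  { apply (sigma_limit _ (fun k => orbit lam (phi k) v)).
    - intros eps Heps. destruct (proj2 Hva eps Heps) as [N HN]. exists N. intros k Hk.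
      apply HN. generalize (increasing_ge phi Hphi k). lia.
    - intros eps Heps. destruct (Hunif eps Heps) as [N HN]. exists N. intros k Hk.
      rewrite <- iterh_Some by apply Hva. now apply HN. }
  specialize (HK _ Hsv). rewrite Hgv, iterh_Some, sigma_sym in HK by apply Hva.
  destruct (Hclose _ HK) as (u & Eu & Hu). injection Eu as <-.
  apply (attracted_orbit lam a n); [apply Hnp|]. apply Hatt.
  specialize (Hcont v ltac:(lra)). rewrite Cmod_minus_sym in Hcont.
  replace (orbit lam n z0 - RtoC a)%C with ((orbit lam n z0 - orbit lam n v) + (orbit lam n v - RtoC a))%C by ring.
  eapply Rle_lt_trans; [apply Cmod_triangle | lra].
Qed.

Lemma fatou_attracted (z0 : C) : fatou lam (Some z0) -> attracted lam a z0.
Proof.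
  intros HF. apply NNPP. intros Hn.
  assert (Hfree : exists d, 0 < d /\ forall v, Cmod (v - z0) < d -> ~ attracted lam a v).
  { apply NNPP. intros h. apply Hn, fatou_closure_attracted; [easy|]. intros d Hd.
    apply NNPP. intros h'. apply h. exists d. split; [easy|]. intros v Hv Hva. apply h'. now exists v. }
  destruct Hfree as (d & Hd & Hfree).
  destruct HF as (U & HU & Hz0 & Hdef & _).
  destruct (HU _ Hz0) as (r & Hr & Hball).
  apply (no_free_disc lam a Ha Ha2 Elam Hlam z0 (Rmin d (r / 2))); [apply Rmin_pos; lra|].
  assert (m1 := Rmin_l d (r / 2)). assert (m2 := Rmin_r d (r / 2)).
  intros v Hv. split; [|apply Hfree; lra]. apply (fatou_no_pole lam v U); [|easy].
  apply Hball. eapply Rle_lt_trans; [apply sigma_le_dist|]. rewrite Cmod_minus_sym. lra.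
Qed.
End FatouBasin.

Theorem theorem6 (lam : R) :
  1 < lam -> lam < (sqrt 2 + 1) * exp (sqrt 2) ->
  forall a : R, a <> 0 ->
  zetah lam (Some (RtoC a)) = Some (RtoC a) ->
  forall w : Chat, julia lam w <-> ~ basin lam (RtoC a) w.
Proof.
  intros H1 H2 a Ha0 Hfix w.
  destruct (zetah_fixed_real lam a H1 H2 Ha0 Hfix) as [[Ha Ha2] Elam].
  unfold julia. apply not_iff_compat.
  destruct w as [z|].
  - rewrite basin_attracted. split; [now apply fatou_attracted | now apply attracted_fatou].
  (* At infinity the first iterate is already undefined, and the basin contains only finite
     points. *)
  - split.
    + intros (U & _ & HU & Hdef & _). exfalso. apply (Hdef 1%nat None HU O); [lia | easy].
    + intros [[z Hz] _]. discriminate.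
Qed.
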